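(* Let $d\ge2$, $\mu\in\mathbb S^{d-1}$, and let $\kappa>0$ be fixed. Let $z_1,z_2,\dots$ be i.i.d. random vectors with distribution $\mathrm{vMF}(\mu,\kappa)$ on $\mathbb S^{d-1}$, and for each $n\ge1$ let $\bar r_n=\frac1n\sum_{i=1}^n z_i$ be the sample mean. Then the maximum likelihood estimate of $\mu$ based on $z_1,\dots,z_n$ is $\hat\mu_n=\bar r_n/\|\bar r_n\|$, and $\hat\mu_n\to\mu$ in probability as $n\to\infty$.
   Context: $\mathbb S^{d-1}$ is the unit sphere of $\mathbb R^d$ and $\|\cdot\|$ the Euclidean norm. $\mathrm{vMF}(\mu,\kappa)$ is the von Mises--Fisher distribution, with density $C_d(\kappa)e^{\kappa\mu^\top z}$ with respect to surface measure on $\mathbb S^{d-1}$, where $C_d(\kappa)$ is the normalizing constant (independent of $\mu$). The maximum likelihood estimate of $\mu$ is the maximizer over $\nu\in\mathbb S^{d-1}$ of $\sum_{i=1}^n\log\big(C_d(\kappa)e^{\kappa\nu^\top z_i}\big)$, with $\kappa$ fixed; $\hat\mu_n$ is defined on the event $\bar r_n\neq0$, which has probability one. *)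

(* Defs.v *)
From HB Require Import structures.
From mathcomp Require Import all_boot all_order all_algebra finmap.
From mathcomp Require Import all_classical all_reals all_analysis.
From mathcomp Require Import measurable_realfun.

Set Implicit Arguments.
Unset Strict Implicit.
Unset Printing Implicit Defensive.

Import Order.TTheory GRing.Theory Num.Theory.
Import numFieldNormedType.Exports.

Local Open Scope classical_set_scope.
Local Open Scope ring_scope.

(* R^n carries the product of the Borel sigma-algebras of its coordinates,
   which is its Borel sigma-algebra. *)
Section measurable_rV.
Context {d} {T : measurableType d}.
Variable n : nat.

Let coord : 'I_n -> 'rV[T]_n -> T := fun i x => x ord0 i.

Let rV_set0 : g_sigma_preimage coord set0.
Proof. exact: sigma_algebra0. Qed.

Let rV_setC A : g_sigma_preimage coord A -> g_sigma_preimage coord (~` A).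
Proof. exact: sigma_algebraC. Qed.

Let rV_bigcup (F : _^nat) : (forall i, g_sigma_preimage coord (F i)) ->
  g_sigma_preimage coord (\bigcup_i (F i)).
Proof. exact: sigma_algebra_bigcup. Qed.

HB.instance Definition _ := @isMeasurable.Build (measure_tuple_display d)
  'rV[T]_n (g_sigma_preimage coord) rV_set0 rV_setC rV_bigcup.

Lemma measurable_coord (i : 'I_n) :
  measurable_fun [set: 'rV[T]_n] (fun x => x ord0 i).
Proof.
move=> _ Y mY; rewrite setTI; apply: sub_sigma_algebra => /=.
rewrite -bigcup_seq/=; exists i => /=; first by rewrite mem_index_enum.
by exists Y => //; rewrite setTI.
Qed.

Lemma measurable_fun_rVP d' (T' : measurableType d') (f : T' -> 'rV[T]_n) :
  measurable_fun [set: T'] f <->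
  forall i, measurable_fun [set: T'] (fun x => f x ord0 i).
Proof.
split=> [mf i|mf].
  exact: (measurableT_comp (measurable_coord i) mf).
suff : g_sigma_preimage (fun i => coord i \o f) `<=` measurable.
  rewrite g_sigma_preimage_comp => prefS _ A mA.
  by apply: prefS; exists A.
apply: smallest_sub; first exact: sigma_algebra_measurable.
move=> A; rewrite -bigcup_seq/= => -[i _ [B mB <-]]; exact: mf.
Qed.

End measurable_rV.

(* Lebesgue measure on R^n, as an iterated product along
   R * R^n -> R^n.+1. *)
Section lebesgue_rV.
Variable R : realType.

Definition consrV n (p : measurableTypeR R * 'rV[R]_n) : 'rV[R]_n.+1 :=
  row_mx (p.1)%:M p.2 : 'rV[R]_(1 + n).

Lemma consrV0 n (p : measurableTypeR R * 'rV[R]_n) : consrV p ord0 ord0 = p.1.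
Proof.
rewrite /consrV (_ : ord0 = lshift n (ord0 : 'I_1)); last exact/val_inj.
by rewrite (@row_mxEl _ 1 1 n) mxE.
Qed.

Lemma consrVS n (p : measurableTypeR R * 'rV[R]_n) (i : 'I_n) :
  consrV p ord0 (lift ord0 i) = p.2 ord0 i.
Proof.
rewrite /consrV (_ : lift ord0 i = rshift 1 i); last exact/val_inj.
by rewrite (@row_mxEr _ 1 1 n).
Qed.

Lemma measurable_consrV n : measurable_fun setT (@consrV n).
Proof.
apply/measurable_fun_rVP => i; case: (unliftP ord0 i) => [j ->|->].
  under eq_fun do rewrite consrVS.
  exact: (measurableT_comp (measurable_coord j) measurable_snd).
under eq_fun do rewrite consrV0.
exact: measurable_fst.
Qed.

Definition unconsrV n (v : 'rV[R]_n.+1) : measurableTypeR R * 'rV[R]_n :=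
  (v ord0 ord0, \row_i v ord0 (lift ord0 i)).

Lemma measurable_unconsrV n : measurable_fun setT (@unconsrV n).
Proof.
apply/measurable_fun_pair => /=; first exact: measurable_coord.
apply/measurable_fun_rVP => i; under eq_fun do rewrite mxE.
exact: measurable_coord.
Qed.

Lemma consrVK n : cancel (@consrV n) (@unconsrV n).
Proof.
move=> [a v]; rewrite /unconsrV consrV0; congr pair.
by apply/rowP => i; rewrite mxE consrVS.
Qed.

Section cons_measure.
Variables (n : nat) (m : {sigma_finite_measure set 'rV[R]_n -> \bar R}).

Definition cons_measure : set 'rV[R]_n.+1 -> \bar R :=
  pushforward (@lebesgue_measure R \x m)%E (@consrV n).

Let cons_measure0 : cons_measure set0 = 0%E.
Proof. by rewrite /cons_measure /pushforward preimage_set0 measure0. Qed.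

Let cons_measure_ge0 A : (0 <= cons_measure A)%E.
Proof. by rewrite /cons_measure /pushforward measure_ge0. Qed.

Let cons_measure_sigma_additive : semi_sigma_additive cons_measure.
Proof.
move=> F mF tF mUF; rewrite /cons_measure /pushforward preimage_bigcup.
have mc := @measurable_consrV n.
apply: measure_semi_sigma_additive.
- by move=> k; rewrite -[X in measurable X]setTI; exact: mc.
- apply/trivIsetP => /= i j _ _ ij; rewrite -preimage_setI.
  by move/trivIsetP : tF => /(_ _ _ _ _ ij) ->//; rewrite preimage_set0.
- by rewrite -preimage_bigcup -[X in measurable X]setTI; exact: mc.
Qed.

HB.instance Definition _ := isMeasure.Build _ _ _ cons_measure
  cons_measure0 cons_measure_ge0 cons_measure_sigma_additive.

Let cons_measure_sigma_finite : sigma_finite setT cons_measure.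
Proof.
have /sigma_finiteP[F [FT ndF Foo]] := sigma_finiteT (@lebesgue_measure R).
have /sigma_finiteP[G [GT ndG Goo]] := sigma_finiteT m.
exists (fun k => @unconsrV n @^-1` (F k `*` G k)).
  rewrite -preimage_bigcup (_ : \bigcup_k _ = setT) ?preimage_setT//.
  rewrite -subTset => -[x y] _.
  have [i _ Fx] : (\bigcup_k F k) x by rewrite -FT.
  have [j _ Gy] : (\bigcup_k G k) y by rewrite -GT.
  exists (maxn i j) => //; split.
  - by move: x Fx; exact/subsetPset/ndF/leq_maxl.
  - by move: y Gy; exact/subsetPset/ndG/leq_maxr.
move=> k; have [mF Fk] := Foo k; have [mG Gk] := Goo k; split.
  rewrite -[X in measurable X]setTI.
  by apply: measurable_unconsrV => //; exact: measurableX.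
rewrite /cons_measure /pushforward -comp_preimage (_ : _ \o _ = id).
  by rewrite preimage_id product_measure1E// lte_mul_pinfty// ge0_fin_numE.
by apply/funext => x /=; rewrite consrVK.
Qed.

HB.instance Definition _ := Measure_isSigmaFinite.Build _ _ _ cons_measure
  cons_measure_sigma_finite.

End cons_measure.

Fixpoint lebesgue_rV n : {sigma_finite_measure set 'rV[R]_n -> \bar R} :=
  match n with
  | 0%N => \d_(0 : 'rV[R]_0)
  | n'.+1 => cons_measure (lebesgue_rV n')
  end.

End lebesgue_rV.

Section euclidean.
Context {R : realType} {n : nat}.
Implicit Types (u v : 'rV[R]_n).

Definition dotv u v : R := \sum_i u ord0 i * v ord0 i.

(* The library norm on matrices, `|v|, is the sup norm. *)
Definition enorm v : R := Num.sqrt (dotv v v).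

Definition unitize v : 'rV[R]_n := (enorm v)^-1 *: v.

Definition usphere : set 'rV[R]_n := [set v | enorm v = 1].

Definition punctured_ball : set 'rV[R]_n := [set v | 0 < enorm v <= 1].

Lemma measurable_enorm : measurable_fun setT enorm.
Proof.
apply: (@measurableT_comp _ _ _ _ _ _ (@Num.sqrt R)) => //.
  by apply: continuous_measurable_fun; exact: sqrt_continuous.
apply: measurable_sum => i.
by apply: measurable_funM; exact: measurable_coord.
Qed.

Lemma measurable_unitize : measurable_fun setT unitize.
Proof.
apply/measurable_fun_rVP => i; under eq_fun do rewrite mxE.
apply: measurable_funM; last exact: measurable_coord.
have -> : (fun v => (enorm v)^-1) = (@powR R ^~ (- 1)) \o enorm.
  by apply/funext => v /=; rewrite powR_inv1// sqrtr_ge0.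
apply: measurableT_comp; first exact: measurable_powR.
exact: measurable_enorm.
Qed.

Lemma measurable_punctured_ball : measurable punctured_ball.
Proof.
rewrite -[X in measurable X]setTI.
have -> : punctured_ball = enorm @^-1` `]0, 1].
  by apply/seteqP; split=> v /=; rewrite in_itv.
by apply: measurable_enorm => //; exact: measurable_itv.
Qed.

End euclidean.
Arguments usphere {R} n.
Arguments punctured_ball {R} n.

(* Surface measure on the unit sphere of R^n, as a measure on R^n carried by
   the sphere: the area of A is n times the Lebesgue measure of the cone
   {t z | 0 < t <= 1, z in A with |z| = 1} over A, so that integration in
   polar coordinates reads dx = r^(n-1) dr dsurface. *)
Section surface_measure.
Variables (R : realType) (n : nat).

Definition surface_measure (A : set 'rV[R]_n) : \bar R :=
  (n%:R%:E * lebesgue_rV R n (unitize @^-1` A `&` punctured_ball n))%E.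

Let mcone (A : set 'rV[R]_n) : measurable A ->
  measurable (unitize @^-1` A `&` punctured_ball n).
Proof.
move=> mA; apply: measurableI; last exact: measurable_punctured_ball.
by rewrite -[X in measurable X]setTI; exact: measurable_unitize.
Qed.

Let surface0 : surface_measure set0 = 0%E.
Proof. by rewrite /surface_measure preimage_set0 set0I measure0 mule0. Qed.

Let surface_ge0 A : (0 <= surface_measure A)%E.
Proof. by rewrite mule_ge0// lee_fin. Qed.

Let surface_sigma_additive : semi_sigma_additive surface_measure.
Proof.
move=> F mF tF mUF; rewrite /surface_measure.
rewrite [X in X @ \oo --> _](_ : _ = (fun k => n%:R%:E *
    \sum_(0 <= i < k) lebesgue_rV R n (unitize @^-1` F i `&` punctured_ball n))%E).
  apply: cvgeZl => //; rewrite preimage_bigcup setI_bigcupl.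
  apply: measure_semi_sigma_additive.
  - by move=> i; exact: mcone.
  - apply/trivIsetP => /= i j _ _ ij; rewrite setIACA -preimage_setI.
    by move/trivIsetP : tF => /(_ _ _ _ _ ij) ->//; rewrite preimage_set0 set0I.
  - by rewrite -setI_bigcupl -preimage_bigcup; exact: mcone.
by apply/funext => k; rewrite ge0_sume_distrr.
Qed.

HB.instance Definition _ := isMeasure.Build _ _ _ surface_measure
  surface0 surface_ge0 surface_sigma_additive.

End surface_measure.

Section von_mises_fisher.
Context {R : realType} {n : nat}.
Implicit Types (mu nu z : 'rV[R]_n) (kappa : R).

(* The normalizing constant of the density for the mean direction mu; that it
   does not depend on mu is a consequence of rotation invariance and is not
   built in. *)
Definition vMF_const mu kappa : R :=
  (fine (\int[@surface_measure R n]_(z in usphere n)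
           (expR (kappa * dotv mu z))%:E))^-1.

Definition vMF_pdf mu kappa z : R :=
  vMF_const mu kappa * expR (kappa * dotv mu z).

Definition vMF mu kappa (A : set 'rV[R]_n) : \bar R :=
  (\int[@surface_measure R n]_(z in A `&` usphere n)
     (vMF_pdf mu kappa z)%:E)%E.

Definition log_likelihood kappa (s : seq 'rV[R]_n) nu : R :=
  \sum_(z <- s) ln (vMF_pdf nu kappa z).

(* Strict inequality: "the" maximizer over the sphere, i.e. existence and
   uniqueness. *)
Definition is_MLE kappa (s : seq 'rV[R]_n) hat : Prop :=
  usphere n hat /\
  forall nu, usphere n nu -> nu != hat ->
    log_likelihood kappa s nu < log_likelihood kappa s hat.

Definition smean (s : seq 'rV[R]_n) : 'rV[R]_n :=
  (size s)%:R^-1 *: \sum_(z <- s) z.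

End von_mises_fisher.

Section random_sequences.
Context {d d'} {T : measurableType d} {E : measurableType d'} {R : realType}.
Variable P : probability T R.

Definition mutually_independent (X : nat -> {RV P >-> E}) : Prop :=
  forall (J : {fset nat}) (A : nat -> set E), (forall j, measurable (A j)) ->
    P (\bigcap_(j in [set` J]) (X j @^-1` A j)) =
    (\prod_(j <- J) P (X j @^-1` A j))%E.

Definition iid (X : nat -> {RV P >-> E}) (Q : set E -> \bar R) : Prop :=
  mutually_independent X /\
  forall i A, measurable A -> distribution P (X i) A = Q A.

Definition cvg_in_probability n (X : nat -> T -> 'rV[R]_n) (x : 'rV[R]_n) :=
  forall eps : R, 0 < eps ->
    P [set t | eps <= enorm (X k t - x)] @[k --> \oo] --> 0%E.

End random_sequences.

(* Main.v *)
(** Uniqueness of the maximizer. Up to a constant and the factor kappa, the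
    log-likelihood of a unit vector nu is its inner product with the sum of the
    data, so by the Cauchy-Schwarz inequality it is maximal exactly at the
    normalized sample mean. That the normalizing constant does not depend on nu
    is the invariance of the surface measure under reflections. It comes from
    the invariance of Lebesgue measure: plane rotations are compositions of
    shears, every vector can be aligned with the first coordinate axis by such
    rotations, and a reflection in any hyperplane is then conjugate to the
    reflection of the first coordinate.

    The sample mean is almost surely nonzero because the last observation is
    independent of the sum of the others and its law has no atom: a point lies
    on a hyperplane through 0, and these are null sets.

    Consistency. Reflections fixing mu show that the mean of the law is c mu for
    some real c. The density ratio exp(- 2 kappa <mu, y>) of the law with mean
    direction - mu has integral 1, so strict convexity of the exponential gives
    c > 0. The second moment of the sum of n centered observations is at most n,
    so Chebyshev's inequality gives convergence of the sample mean to c mu, and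
    normalization is continuous there. *)
From HB Require Import structures.
Require Import Defs.
From mathcomp Require Import all_boot all_order all_algebra finmap.
From mathcomp Require Import all_classical all_reals all_analysis.
From mathcomp Require Import measurable_realfun ring lra.
Import Order.TTheory GRing.Theory Num.Theory.
Import numFieldNormedType.Exports.
Local Open Scope classical_set_scope.
Local Open Scope ring_scope.

Set Implicit Arguments.
Unset Strict Implicit.
Unset Printing Implicit Defensive.

(** * Measure-preserving maps *)

Definition preserves {d} {T : measurableType d} {R : realType}
    (m : set T -> \bar R) (f : T -> T) :=
  measurable_fun setT f /\
  forall A, measurable A -> m (f @^-1` A) = m A.

Section preserves_theory.
Context {d} {T : measurableType d} {R : realType}.
Implicit Types (m : set T -> \bar R) (f g : T -> T).

Lemma preserves_comp m f g : preserves m f -> preserves m g ->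
  preserves m (g \o f).
Proof.
move=> [mf pf] [mg pg]; split; first exact: measurableT_comp.
move=> A mA; rewrite comp_preimage pf ?pg//.
by rewrite -[X in measurable X]setTI; exact: mg.
Qed.

Lemma preserves_inv m f g : measurable_fun setT g -> cancel g f ->
  cancel f g -> preserves m f -> preserves m g.
Proof.
move=> mg gK fK [mf pf]; split => // A mA.
rewrite -pf; last by rewrite -[X in measurable X]setTI; exact: mg.
by rewrite -comp_preimage (_ : g \o f = id)// funeqE => x /=; rewrite fK.
Qed.

End preserves_theory.

Section skew_product.
Context {d1 d2} {T1 : measurableType d1} {T2 : measurableType d2} {R : realType}.
Variables (m1 : {sigma_finite_measure set T1 -> \bar R})
          (m2 : {sigma_finite_measure set T2 -> \bar R}).

(** [preserves_skew2] computes with x-sections. A map that moves the first coordinate needs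
    y-sections, which the reversed product provides. *)
Lemma product_measureC A : measurable A -> (m1 \x m2)%E A = (m1 \x^ m2)%E A.
Proof.
by apply: product_measure_unique => B C mB mC; exact: product_measure2E.
Qed.

(** By Fubini: the section at [x] of the preimage of [A] is the preimage under [h x] of the section
    of [A], so both have the same measure. *)
Lemma preserves_skew2 (h : T1 -> T2 -> T2) :
  measurable_fun setT (fun p : T1 * T2 => h p.1 p.2) ->
  (forall x, preserves m2 (h x)) ->
  preserves (m1 \x m2)%E (fun p => (p.1, h p.1 p.2)).
Proof.
move=> mh ph; split.
  by apply/measurable_fun_pair => //=; exact: measurable_fst.
move=> A mA; rewrite /product_measure1/=; apply: eq_integral => x _.
rewrite /= -[RHS](proj2 (ph x)); last exact: measurable_xsection.
by congr (m2 _); apply/seteqP; split => y; rewrite /xsection /= !inE.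
Qed.

Lemma preserves_skew1 (h : T2 -> T1 -> T1) :
  measurable_fun setT (fun p : T1 * T2 => h p.2 p.1) ->
  (forall y, preserves m1 (h y)) ->
  preserves (m1 \x m2)%E (fun p => (h p.2 p.1, p.2)).
Proof.
move=> mh ph.
have mH : measurable_fun setT (fun p : T1 * T2 => (h p.2 p.1, p.2)).
  by apply/measurable_fun_pair => //=; exact: measurable_snd.
split=> // A mA; rewrite !product_measureC//; last first.
  by rewrite -[X in measurable X]setTI; exact: mH.
rewrite /product_measure2/=; apply: eq_integral => y _.
rewrite /= -[RHS](proj2 (ph y)); last exact: measurable_ysection.
by congr (m1 _); apply/seteqP; split => x; rewrite /ysection /= !inE.
Qed.

End skew_product.

Section lebesgue_line.
Context {R : realType}.

Lemma preserves_lebesgue_shift (c : R) :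
  preserves (@lebesgue_measure R) (fun x : measurableTypeR R => x + c).
Proof.
have mc : measurable_fun setT (fun x : measurableTypeR R => x + c : measurableTypeR R).
  exact: measurable_funD.
pose mmfun := isMeasurableFun.Build _ _ _ _ _ mc.
pose mf : {mfun _ >-> _} :=
  HB.pack (fun x : measurableTypeR R => x + c : measurableTypeR R) mmfun.
split=> // A mA.
apply/esym; rewrite -[RHS]/(pushforward (@lebesgue_measure R) mf A).
apply: lebesgue_measure_unique => //= _ [[a b]] _ <-.
rewrite /pushforward/= (_ : _ @^-1` _ = `]a - c, b - c]%classic); last first.
  by apply/seteqP; split => x /=; rewrite !in_itv/= ltrBlDr lerBrDr.
rewrite !lebesgue_measure_itv/= !lte_fin ltrD2r; congr (if _ then _ else _).
by congr EFin; lra.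
Qed.

Lemma preserves_lebesgue_opp :
  preserves (@lebesgue_measure R) (fun x : measurableTypeR R => - x).
Proof.
by split; [exact: measurable_funN | move=> A mA; exact: lebesgue_measureN].
Qed.

End lebesgue_line.

(** * Euclidean geometry and isometries preserving Lebesgue measure *)

Section dot_product.
Context {R : realType} {n : nat}.
Implicit Types (u v : 'rV[R]_n) (M : 'M[R]_n).

Lemma dotvE u v : dotv u v = (u *m v^T) 0 0.
Proof. by rewrite mxE; apply: eq_bigr => i _; rewrite mxE. Qed.

Lemma dotvC u v : dotv u v = dotv v u.
Proof. by apply: eq_bigr => i _; rewrite mulrC. Qed.

Lemma dotvDr u v w : dotv u (v + w) = dotv u v + dotv u w.
Proof. by rewrite -big_split; apply: eq_bigr => i _; rewrite mxE mulrDr. Qed.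

Lemma dotvDl u v w : dotv (v + w) u = dotv v u + dotv w u.
Proof. by rewrite dotvC dotvDr !(dotvC u). Qed.

Lemma dotvZr u v (a : R) : dotv u (a *: v) = a * dotv u v.
Proof. by rewrite /dotv mulr_sumr; apply: eq_bigr => i _; rewrite mxE mulrCA. Qed.

Lemma dotvZl u v (a : R) : dotv (a *: u) v = a * dotv u v.
Proof. by rewrite dotvC dotvZr dotvC. Qed.

Lemma dotvNr u v : dotv u (- v) = - dotv u v.
Proof. by rewrite -scaleN1r dotvZr mulN1r. Qed.

Lemma dotvNl u v : dotv (- u) v = - dotv u v.
Proof. by rewrite dotvC dotvNr dotvC. Qed.

Lemma dotv0r u : dotv u 0 = 0.
Proof. by rewrite -(scale0r u) dotvZr mul0r. Qed.

Lemma dotv_sumr u (s : seq 'rV[R]_n) :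
  dotv u (\sum_(v <- s) v) = \sum_(v <- s) dotv u v.
Proof.
by elim: s => [|v s IHs]; rewrite ?big_nil ?dotv0r// !big_cons dotvDr IHs.
Qed.

Lemma dotv_delta v i : dotv v (delta_mx 0 i) = v 0 i.
Proof.
rewrite /dotv (bigD1 i)//= !mxE !eqxx mulr1 big1 ?addr0// => j ji.
by rewrite mxE eqxx (negbTE ji) mulr0.
Qed.

Lemma dotv_ge0 v : 0 <= dotv v v.
Proof. by apply: sumr_ge0 => i _; exact: sqr_ge0. Qed.

Lemma dotv_eq0 v : (dotv v v == 0) = (v == 0).
Proof.
apply/idP/idP => [|/eqP ->]; last by rewrite dotv0r.
rewrite psumr_eq0; last by move=> i _; exact: sqr_ge0.
move=> /allP v0; apply/eqP/rowP => i; rewrite mxE.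
by have := v0 i (mem_index_enum i); rewrite mulf_eq0 orbb => /eqP.
Qed.

Lemma enorm_sq v : enorm v ^+ 2 = dotv v v.
Proof. by rewrite sqr_sqrtr// dotv_ge0. Qed.

Lemma enorm_ge0 v : 0 <= enorm v.
Proof. exact: sqrtr_ge0. Qed.

Lemma enorm_eq0 v : (enorm v == 0) = (v == 0).
Proof. by rewrite -dotv_eq0 -enorm_sq sqrf_eq0. Qed.

Lemma enorm_gt0 v : (0 < enorm v) = (v != 0).
Proof. by rewrite lt0r enorm_ge0 enorm_eq0 andbT. Qed.

Lemma enormZ v (a : R) : enorm (a *: v) = `|a| * enorm v.
Proof.
by rewrite /enorm dotvZl dotvZr mulrA -expr2 sqrtrM ?sqr_ge0// sqrtr_sqr.
Qed.

Lemma usphereP v : usphere n v <-> dotv v v = 1.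
Proof.
split; first by rewrite -enorm_sq /usphere /= => ->; rewrite expr1n.
by rewrite /usphere /= /enorm => ->; rewrite sqrtr1.
Qed.

Lemma unitize_sphere v : v != 0 -> usphere n (unitize v).
Proof.
rewrite -enorm_gt0 => v0.
by rewrite /usphere /= enormZ gtr0_norm ?invr_gt0// mulVf// gt_eqF.
Qed.

Lemma dotv_mulmx u v M : M *m M^T = 1%:M -> dotv (u *m M) (v *m M) = dotv u v.
Proof. by move=> MM; rewrite !dotvE trmx_mul mulmxA -(mulmxA u) MM mulmx1. Qed.

Lemma enorm_mulmx v M : M *m M^T = 1%:M -> enorm (v *m M) = enorm v.
Proof. by move=> MM; rewrite /enorm dotv_mulmx. Qed.

(** The entries of [M *m M^T] are the inner products of the rows of [M], which are the images of the
    basis vectors. Orthogonality can thus be read off from the formula for [v *m M]. *)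
Lemma orthogonal_dotvP M : (forall u v, dotv (u *m M) (v *m M) = dotv u v) ->
  M *m M^T = 1%:M.
Proof.
move=> dM; apply/matrixP => i j.
transitivity (dotv (row i M) (row j M)).
  by rewrite [LHS]mxE; apply: eq_bigr => k _; rewrite !mxE.
by rewrite !rowE dM dotv_delta !mxE eqxx /= eq_sym.
Qed.

End dot_product.

(** * Shears, translations and a coordinate reflection on R^n *)

Section lebesgue_isometries.
Context {R : realType}.

Lemma unconsrVK n : cancel (@unconsrV R n) (@consrV R n).
Proof.
move=> v; apply/rowP => i; case: (unliftP ord0 i) => [j ->|->].
  by rewrite consrVS mxE.
by rewrite consrV0.
Qed.

Lemma lebesgue_rVS n (A : set 'rV[R]_n.+1) : lebesgue_rV R n.+1 A =
  (@lebesgue_measure R \x lebesgue_rV R n)%E (@consrV R n @^-1` A).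
Proof. by []. Qed.

Lemma preserves_consrV n F : preserves (@lebesgue_measure R \x lebesgue_rV R n)%E F ->
  preserves (lebesgue_rV R n.+1) (@consrV R n \o F \o @unconsrV R n).
Proof.
move=> [mF pF]; split.
  apply: measurableT_comp; last exact: measurable_unconsrV.
  by apply: measurableT_comp => //; exact: measurable_consrV.
move=> A mA; rewrite !lebesgue_rVS.
have -> : @consrV R n @^-1` ((@consrV R n \o F \o @unconsrV R n) @^-1` A) =
    F @^-1` (@consrV R n @^-1` A).
  by apply/seteqP; split => p /=; rewrite consrVK.
by apply: pF; rewrite -[X in measurable X]setTI; exact: measurable_consrV.
Qed.

Lemma preserves_consrV1 n (h : 'rV[R]_n -> measurableTypeR R -> measurableTypeR R) :
  measurable_fun setT (fun p : measurableTypeR R * 'rV[R]_n => h p.2 p.1) ->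
  (forall w, preserves (@lebesgue_measure R) (h w)) ->
  preserves (lebesgue_rV R n.+1)
    (fun v => consrV (h (unconsrV v).2 (unconsrV v).1, (unconsrV v).2)).
Proof.
move=> mh ph; have := preserves_consrV
  (@preserves_skew1 _ _ _ _ _ (@lebesgue_measure R) (lebesgue_rV R n) h mh ph).
exact.
Qed.

Lemma preserves_consrV2 n (h : measurableTypeR R -> 'rV[R]_n -> 'rV[R]_n) :
  measurable_fun setT (fun p : measurableTypeR R * 'rV[R]_n => h p.1 p.2) ->
  (forall x, preserves (lebesgue_rV R n) (h x)) ->
  preserves (lebesgue_rV R n.+1)
    (fun v => consrV ((unconsrV v).1, h (unconsrV v).1 (unconsrV v).2)).
Proof.
move=> mh ph; have := preserves_consrV
  (@preserves_skew2 _ _ _ _ _ (@lebesgue_measure R) (lebesgue_rV R n) h mh ph).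
exact.
Qed.

Lemma measurable_mulmxr n (M : 'M[R]_n) :
  measurable_fun setT (fun v : 'rV[R]_n => v *m M).
Proof.
apply/measurable_fun_rVP => i; under eq_fun do rewrite mxE.
apply: measurable_sum => j; apply: measurable_funM => //.
exact: measurable_coord.
Qed.

(** Invariance of Lebesgue measure is carried along with orthogonality and is built up from
    generators, so that no change of variables with determinants enters. *)
Definition rigid n (M : 'M[R]_n) :=
  M *m M^T = 1%:M /\ preserves (lebesgue_rV R n) (mulmx^~ M).

Lemma rigid1 n : rigid (1%:M : 'M[R]_n).
Proof.
split; first by rewrite trmx1 mulmx1.
split; first exact: measurable_mulmxr.
by move=> A mA; under eq_fun do rewrite mulmx1.
Qed.

Lemma rigidM n (M N : 'M[R]_n) : rigid M -> rigid N -> rigid (M *m N).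
Proof.
move=> [MM pM] [NN pN]; split.
  by rewrite trmx_mul mulmxA -(mulmxA M) NN mulmx1.
rewrite (_ : mulmx^~ _ = mulmx^~ N \o mulmx^~ M); first exact: preserves_comp.
by apply/funext => v /=; rewrite mulmxA.
Qed.

Lemma rigidT n (M : 'M[R]_n) : rigid M -> rigid M^T.
Proof.
move=> [MM pM]; have MM' := mulmx1C MM; split; first by rewrite trmxK.
apply: preserves_inv pM; first exact: measurable_mulmxr.
  by move=> v; rewrite -mulmxA MM' mulmx1.
by move=> v; rewrite -mulmxA MM mulmx1.
Qed.

(** On row vectors this adds [t] times coordinate [j] to coordinate [i]. The case [i = j] scales
    that coordinate by [1 + t], so [t = - 2] reflects it. *)
Definition shear_mx n (i j : 'I_n) (t : R) : 'M[R]_n := 1%:M + t *: delta_mx j i.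

Lemma mul_row_delta n (v : 'rV[R]_n) (i j : 'I_n) :
  v *m delta_mx i j = v 0 i *: delta_mx 0 j.
Proof.
apply/rowP => k; rewrite !mxE (bigD1 i)//= !mxE !eqxx big1 ?addr0//= => l li.
by rewrite mxE (negbTE li) mulr0.
Qed.

Lemma mul_shear_mx n (i j : 'I_n) t (v : 'rV[R]_n) :
  v *m shear_mx i j t = v + (t * v 0 j) *: delta_mx 0 i.
Proof. by rewrite mulmxDr mulmx1 -scalemxAr mul_row_delta scalerA. Qed.

Lemma preserves_translate n (t : R) :
  preserves (lebesgue_rV R n.+1) (fun v => v + t *: delta_mx 0 ord0).
Proof.
rewrite (_ : (fun _ => _) = fun v =>
    consrV ((unconsrV v).1 + t, (unconsrV v).2)); last first.
  apply/funext => v; apply/rowP => i; case: (unliftP ord0 i) => [j ->|->] /=.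
    by rewrite consrVS/= !mxE mulr0 addr0.
  by rewrite consrV0/= !mxE mulr1.
apply: (preserves_consrV1 (h := fun _ x => x + t)) => /=.
  by apply: measurable_funD => //; exact: measurable_fst.
by move=> _; exact: preserves_lebesgue_shift.
Qed.

Lemma preserves_shear01 n t :
  preserves (lebesgue_rV R n.+2) (mulmx^~ (shear_mx ord0 (lift ord0 ord0) t)).
Proof.
rewrite (_ : mulmx^~ _ = fun v => consrV
    ((unconsrV v).1 + t * (unconsrV v).2 0 ord0, (unconsrV v).2)); last first.
  apply/funext => v; rewrite mul_shear_mx; apply/rowP => i.
  case: (unliftP ord0 i) => [j ->|->] /=.
    by rewrite consrVS/= !mxE mulr0 addr0.
  by rewrite consrV0/= !mxE mulr1.
apply: (preserves_consrV1 (h := fun v x => x + t * v 0 ord0)) => /=.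
  apply: measurable_funD; first exact: measurable_fst.
  apply: measurable_funM => //.
  by apply: (measurableT_comp (measurable_coord _)); exact: measurable_snd.
by move=> v; exact: preserves_lebesgue_shift.
Qed.

Lemma preserves_shear10 n t :
  preserves (lebesgue_rV R n.+2) (mulmx^~ (shear_mx (lift ord0 ord0) ord0 t)).
Proof.
rewrite (_ : mulmx^~ _ = fun v => consrV ((unconsrV v).1,
    (unconsrV v).2 + (t * (unconsrV v).1) *: delta_mx 0 ord0)); last first.
  apply/funext => v; rewrite mul_shear_mx; apply/rowP => i.
  case: (unliftP ord0 i) => [j ->|->] /=.
    by rewrite consrVS/= !mxE !eqxx /= (inj_eq (@lift_inj _ _)).
  by rewrite consrV0/= !mxE/= mulr0 addr0.
apply: (preserves_consrV2 (h := fun x v => v + (t * x) *: delta_mx 0 ord0)) => /=.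
  apply/measurable_fun_rVP => i; under eq_fun do rewrite !mxE.
  apply: measurable_funD.
    by apply: (measurableT_comp (measurable_coord _)); exact: measurable_snd.
  apply: measurable_funM => //.
  by apply: measurable_funM => //; exact: measurable_fst.
by move=> v; exact: preserves_translate.
Qed.

Lemma rigid_flip n : rigid (shear_mx ord0 ord0 (- 2) : 'M[R]_n.+1).
Proof.
split.
  apply: orthogonal_dotvP => u v; rewrite !mul_shear_mx.
  rewrite !(dotvDl, dotvDr, dotvZl, dotvZr, dotv_delta) ![dotv (delta_mx _ _) _]dotvC.
  rewrite !dotv_delta !mxE !eqxx /=; ring.
rewrite (_ : mulmx^~ _ = fun v =>
    consrV (- (unconsrV v).1, (unconsrV v).2)); last first.
  apply/funext => v; rewrite mul_shear_mx; apply/rowP => i.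
  case: (unliftP ord0 i) => [j ->|->] /=.
    by rewrite consrVS/= !mxE mulr0 addr0.
  by rewrite consrV0/= !mxE/= mulr1; ring.
apply: (preserves_consrV1 (h := fun _ x => - x)) => /=.
  by apply: measurableT_comp => //; exact: measurable_fst.
by move=> _; exact: preserves_lebesgue_opp.
Qed.

Lemma rigid_lift0 n (M : 'M[R]_n) : rigid M ->
  rigid (lift0_mx M : 'M[R]_n.+1).
Proof.
move=> [MM pM]; split.
  rewrite /lift0_mx (@tr_block_mx _ 1 n 1 n) !trmx0 trmx1.
  rewrite (@mulmx_block _ 1 n 1 n 1 n) !mulmx0 !mul0mx mulmx1 MM addr0 add0r.
  by rewrite addr0 add0r (@scalar_mx_block _ 1 n 1).
rewrite (_ : mulmx^~ _ = fun v =>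
    consrV ((unconsrV v).1, (unconsrV v).2 *m M)); last first.
  apply/funext => v; rewrite -[in LHS](unconsrVK v) /consrV /lift0_mx.
  by rewrite (@mul_row_block _ 1 1 n 1 n) !mulmx0 addr0 add0r mulmx1.
apply: (preserves_consrV2 (h := fun _ v => v *m M)) => //=.
by apply: (measurableT_comp (measurable_mulmxr M)); exact: measurable_snd.
Qed.

End lebesgue_isometries.

(** * Plane rotations, alignment with an axis, and hyperplane reflections *)

Section householder.
Context {R : realType}.

(** Here [c] and [s] play the cosine and the sine. As a perturbation of the identity, it acts by
    adding multiples of the first two basis vectors. *)
Definition rotation_mx n (c s : R) : 'M[R]_n.+2 :=
  1%:M + (c - 1) *: (delta_mx ord0 ord0 + delta_mx (lift ord0 ord0) (lift ord0 ord0))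
  + s *: (delta_mx ord0 (lift ord0 ord0) - delta_mx (lift ord0 ord0) ord0).

Lemma mul_rotation_mx n (c s : R) (v : 'rV[R]_n.+2) : v *m rotation_mx n c s =
  v + ((c - 1) * v 0 ord0 - s * v 0 (lift ord0 ord0)) *: delta_mx 0 ord0 +
  (s * v 0 ord0 + (c - 1) * v 0 (lift ord0 ord0)) *: delta_mx 0 (lift ord0 ord0).
Proof.
rewrite !(mulmxDr, mulmxN) mulmx1 -!scalemxAr !(mulmxDr, mulmxN) !mul_row_delta.
rewrite !(scalerDr, scalerDl, scalerN, scaleNr, scalerA).
by apply/rowP => i; rewrite !mxE; ring.
Qed.

Lemma orthogonal_rotation n (c s : R) : c ^+ 2 + s ^+ 2 = 1 ->
  rotation_mx n c s *m (rotation_mx n c s)^T = 1%:M.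
Proof.
move=> cs1; apply: orthogonal_dotvP => u v; rewrite !mul_rotation_mx.
rewrite !(dotvDl, dotvDr, dotvZl, dotvZr, dotv_delta).
rewrite ![dotv (delta_mx _ _) _]dotvC !dotv_delta !mxE !eqxx /=.
have c2 : c ^+ 2 = 1 - s ^+ 2 by lra.
by ring: c2.
Qed.

(* A rotation of angle t is a composition of three shears with coefficients
   -tan(t/2), sin t and -tan(t/2), unless t = pi. *)
Lemma rigid_rotation_neqN1 n (c s : R) : c ^+ 2 + s ^+ 2 = 1 -> 1 + c != 0 ->
  rigid (rotation_mx n c s).
Proof.
move=> cs1 c1; pose t := - (s / (1 + c)).
pose S1 : 'M[R]_n.+2 := shear_mx ord0 (lift ord0 ord0) t.
pose S2 : 'M[R]_n.+2 := shear_mx (lift ord0 ord0) ord0 s.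
split; first exact: orthogonal_rotation.
rewrite (_ : mulmx^~ _ = mulmx^~ S1 \o mulmx^~ S2 \o mulmx^~ S1).
  apply: preserves_comp; first exact: preserves_shear01.
  apply: preserves_comp; first exact: preserves_shear10.
  exact: preserves_shear01.
apply/funext => v /=; rewrite mul_rotation_mx !mul_shear_mx.
(* The composition of the three shears has off-diagonal coefficients [s] and [2 t + s t^2]; the
   relations below identify it with the rotation. *)
have st : s * t = c - 1.
  have -> : s * t = - (s ^+ 2 / (1 + c)) by rewrite /t; ring.
  have -> : s ^+ 2 = (1 - c) * (1 + c) by lra.
  by rewrite mulfK//; ring.
have tc : t * (1 + c) = - s by rewrite /t mulNr divfK.
have tst : s * t ^+ 2 = - s - 2 * t by rewrite expr2 mulrA st -tc; ring.
by rewrite -st; apply/rowP => i; rewrite !mxE !eqxx /=; ring: tst.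
Qed.

(** The remaining angle pi is twice a quarter turn, to which the shear decomposition applies. *)
Lemma rigid_rotation n (c s : R) : c ^+ 2 + s ^+ 2 = 1 ->
  rigid (rotation_mx n c s).
Proof.
move=> cs1; have [c1|] := eqVneq (1 + c) 0; last exact: rigid_rotation_neqN1.
have c_N1 : c = -1 by lra.
have s0 : s = 0.
  by apply/eqP; rewrite -sqrf_eq0; apply/eqP; move: cs1; rewrite c_N1; lra.
have quarter : rigid (rotation_mx n 0 1).
  by apply: rigid_rotation_neqN1; rewrite ?expr0n ?expr1n ?add0r// addr0 oner_eq0.
rewrite (_ : rotation_mx n c s = rotation_mx n 0 1 *m rotation_mx n 0 1).
  exact: rigidM.
apply/row_matrixP => i; rewrite !rowE mulmxA !mul_rotation_mx c_N1 s0.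
apply/rowP => k; move: (delta_mx 0 i) => v; rewrite !mxE !eqxx /=.
by rewrite ?mulr0 ?mulr1; ring.
Qed.

(** Induction on the dimension: align the tail of [v] inside its own space, which leaves at most two
    nonzero coordinates, then rotate in their plane. In dimension one a negative coordinate is
    reflected. *)
Lemma rigid_align n (v : 'rV[R]_n.+1) :
  exists2 M, rigid M & v *m M = enorm v *: delta_mx 0 ord0.
Proof.
elim: n v => [|n IHn] v.
  have vE : v = v 0 0 *: delta_mx 0 ord0.
    by apply/rowP => i; rewrite ord1 !mxE mulr1.
  have nv : enorm v = `|v 0 0|.
    by rewrite /enorm /dotv big_ord1 -expr2 sqrtr_sqr.
  have [v0|v0] := leP 0 (v 0 0).
    exists 1%:M; first exact: rigid1.
    by rewrite mulmx1 nv ger0_norm.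
  exists (shear_mx ord0 ord0 (- 2)); first exact: rigid_flip.
  rewrite mul_shear_mx nv ltr0_norm// {1}vE -scalerDl; congr (_ *: _).
  by ring.
have [/eqP|v0] := eqVneq (enorm v) 0.
  rewrite enorm_eq0 => /eqP ->; exists 1%:M; first exact: rigid1.
  by rewrite mul0mx /enorm dotv0r sqrtr0 scale0r.
have [w /= vE] : exists w, v = consrV w by exists (unconsrV v); rewrite unconsrVK.
have [M isoM ME] := IHn w.2.
set b := enorm w.2 in ME.
have vME : v *m lift0_mx M = consrV (w.1, b *: delta_mx 0 ord0).
  rewrite vE /consrV /lift0_mx (@mul_row_block _ 1 1 n.+1 1 n.+1).
  by rewrite !mulmx0 addr0 add0r mulmx1 ME.
have vn : enorm v ^+ 2 = w.1 ^+ 2 + b ^+ 2.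
  rewrite !enorm_sq vE /dotv big_ord_recl consrV0; congr (_ + _).
  by apply: eq_bigr => i _; rewrite !consrVS.
set r := enorm v in v0 vn *.
(* With cosine [w.1 / r] and sine [- (b / r)] the pair [(w.1, b)] goes to [(r, 0)]. *)
exists (lift0_mx M *m rotation_mx n (w.1 / r) (- (b / r))).
  apply: rigidM; first exact: rigid_lift0.
  by apply: rigid_rotation; rewrite sqrrN !exprMn -mulrDl -vn exprVn divff// sqrf_eq0.
rewrite mulmxA vME mul_rotation_mx.
have := consrV0 (w.1, b *: delta_mx 0 ord0 : 'rV_n.+1).
have := consrVS (w.1, b *: delta_mx 0 ord0 : 'rV_n.+1).
move: (consrV _) => u /= uS u0; apply/rowP => i.
rewrite !mxE u0 uS !mxE !eqxx /= mulr1.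
have rE : r = (w.1 ^+ 2 + b ^+ 2) / r by rewrite -vn expr2 mulfK.
case: (unliftP ord0 i) => [j ->|->]; last first.
  by rewrite u0 /= !mulr1 mulr0 addr0 [RHS]rE; field.
rewrite uS !mxE /= (inj_eq lift_inj) mulr0 addr0.
by case: (j == ord0); rewrite ?mulr0 ?addr0// !mulr1; field.
Qed.

Definition householder_mx n (u : 'rV[R]_n) : 'M[R]_n :=
  1%:M - (2 / dotv u u) *: (u^T *m u).

Lemma mul_householder_mx n (u v : 'rV[R]_n) :
  v *m householder_mx u = v - (2 * dotv v u / dotv u u) *: u.
Proof.
rewrite mulmxBr mulmx1 -scalemxAr mulmxA [v *m u^T]mx11_scalar mul_scalar_mx.
by rewrite -dotvE scalerA mulrAC.
Qed.

(** If [M] aligns [u] with the first axis, the reflection along [u] is [M], then the flip of the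
    first coordinate, then [M^T]. *)
Lemma rigid_householder n (u : 'rV[R]_n) : u != 0 -> rigid (householder_mx u).
Proof.
case: n u => [|n] u u0; first by move: u0; rewrite thinmx0 eqxx.
have [M isoM ME] := rigid_align u.
have [MM _] := isoM.
have nu0 : enorm u != 0 by rewrite enorm_eq0.
(* The inverse of [M] carries the first basis vector back to the direction of [u]. *)
have eM : delta_mx 0 ord0 *m M^T = (enorm u)^-1 *: u.
  have -> : delta_mx 0 ord0 = (enorm u)^-1 *: (u *m M) :> 'rV[R]_n.+1.
    by rewrite ME scalerA mulVf// scale1r.
  by rewrite -scalemxAl -mulmxA MM mulmx1.
have := rigidM (rigidM isoM (rigid_flip n)) (rigidT isoM).
rewrite /shear_mx mulmxDr mulmxDl mulmx1 MM -scalemxAr -scalemxAl.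
rewrite -(mul_delta_mx (ord0 : 'I_1)) mulmxA -[_ *m _ *m M^T]mulmxA eM.
rewrite (_ : M *m delta_mx ord0 ord0 = ((enorm u)^-1 *: u)^T); last first.
  by rewrite -eM trmx_mul trmxK trmx_delta.
rewrite -scalemxAr [(_ *: _)^T]linearZ/= -scalemxAl !scalerA /householder_mx -enorm_sq.
suff -> : -2 * ((enorm u)^-1 / enorm u) = - (2 / enorm u ^+ 2) by rewrite scaleNr.
by field.
Qed.

End householder.

(** * Invariance of the surface measure and of the von Mises-Fisher law *)

Section surface_isometries.
Context {R : realType} {n : nat}.
Implicit Types (u v mu nu : 'rV[R]_n) (M : 'M[R]_n).

(** An orthogonal map commutes with [unitize] and fixes the punctured ball, so the cone over a
    preimage is the preimage of the cone. *)
Lemma preserves_surface M : rigid M ->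
  preserves (@surface_measure R n) (mulmx^~ M).
Proof.
move=> [MM pM]; split=> [|A mA]; first exact: measurable_mulmxr.
rewrite /surface_measure; congr (_ * _)%E.
rewrite -[RHS](proj2 pM); last first.
  apply: measurableI; last exact: measurable_punctured_ball.
  by rewrite -[X in measurable X]setTI; exact: measurable_unitize.
congr (lebesgue_rV R n _); apply/seteqP; split => v /=;
  by rewrite /punctured_ball /unitize /= enorm_mulmx// -scalemxAl.
Qed.

Lemma measurable_usphere : measurable (usphere n : set 'rV[R]_n).
Proof.
rewrite -[X in measurable X]setTI.
rewrite (_ : usphere n = @enorm R n @^-1` [set 1]); last by [].
by apply: measurable_enorm.
Qed.

Lemma measurable_dotv u : measurable_fun setT (dotv u).
Proof.
apply: measurable_sum => i; apply: measurable_funM => //.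
exact: measurable_coord.
Qed.

Lemma measurable_vMF_pdf mu (kappa : R) : measurable_fun setT (vMF_pdf mu kappa).
Proof.
apply: measurable_funM => //; apply: measurableT_comp => //.
by apply: measurable_funM => //; exact: measurable_dotv.
Qed.

Lemma vMF_const_ge0 mu (kappa : R) : 0 <= vMF_const mu kappa.
Proof.
by rewrite invr_ge0 fine_ge0// integral_ge0.
Qed.

Lemma vMF_pdf_ge0 mu (kappa : R) v : 0 <= vMF_pdf mu kappa v.
Proof. by rewrite mulr_ge0// ?vMF_const_ge0// expR_ge0. Qed.

Lemma ge0_integral_rigid M (D : set 'rV[R]_n) (f : 'rV[R]_n -> \bar R) :
  rigid M -> measurable D -> measurable_fun setT f -> (forall v, 0 <= f v)%E ->
  (\int[@surface_measure R n]_(v in D) f v =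
   \int[@surface_measure R n]_(v in (mulmx^~ M) @^-1` D) f (v *m M))%E.
Proof.
move=> isoM mD mf f0; have [mM pM] := preserves_surface isoM.
rewrite -(@ge0_integral_pushforward _ _ _ _ _ _ mM)//; last first.
  exact: measurable_funS mf.
apply: eq_measure_integral => A mA _.
exact/esym/pM.
Qed.

(** Two distinct unit vectors are exchanged by the reflection along their difference. Equal lengths
    give [|mu - nu|^2 = 2 - 2 <nu, mu>], hence the coefficient -1. *)
Lemma householder_swap mu nu : usphere n mu -> usphere n nu -> mu != nu ->
  nu *m householder_mx (mu - nu) = mu.
Proof.
move=> /usphereP mu1 /usphereP nu1 munu; rewrite mul_householder_mx.
have d0 : dotv (mu - nu) (mu - nu) != 0 by rewrite dotv_eq0 subr_eq0.
have dE : dotv (mu - nu) (mu - nu) = 2 - 2 * dotv nu mu.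
  rewrite !(dotvDl, dotvDr, dotvNr, dotvNl) mu1 nu1 (dotvC mu nu); ring.
rewrite dE in d0 *.
rewrite (_ : 2 * _ / _ = -1); first by rewrite scaleN1r opprK addrC subrK.
by rewrite dotvDr dotvNr nu1; field.
Qed.

Lemma vMF_const_unif mu nu (kappa : R) : usphere n mu -> usphere n nu ->
  vMF_const mu kappa = vMF_const nu kappa.
Proof.
move=> mu1 nu1; have [->//|munu] := eqVneq mu nu.
have hE := householder_swap mu1 nu1 munu.
set H := householder_mx _ in hE.
have isoH : rigid H by apply: rigid_householder; rewrite subr_eq0.
rewrite /vMF_const; congr ((fine _)^-1).
rewrite (ge0_integral_rigid isoH); last 3 first.
- exact: measurable_usphere.
- apply/measurable_EFinP; apply: measurableT_comp => //.
  by apply: measurable_funM => //; exact: measurable_dotv.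
- by move=> v; rewrite lee_fin expR_ge0.
have -> : (mulmx^~ H) @^-1` (usphere n) = usphere n.
  by apply/seteqP; split => v; rewrite /usphere /= enorm_mulmx//; case: isoH.
by apply: eq_integral => v _; rewrite -{1}hE dotv_mulmx//; case: isoH.
Qed.

(** A rigid map fixing [mu] leaves both the density and the surface measure unchanged. These
    symmetries determine the direction of the mean. *)
Lemma vMF_rigid mu (kappa : R) M A : rigid M -> mu *m M = mu -> measurable A ->
  vMF mu kappa ((mulmx^~ M) @^-1` A) = vMF mu kappa A.
Proof.
move=> isoM muM mA; have [MM _] := isoM.
rewrite /vMF [RHS](ge0_integral_rigid isoM); last 3 first.
- by apply: measurableI => //; exact: measurable_usphere.
- by apply/measurable_EFinP; exact: measurable_vMF_pdf.
- by move=> v; rewrite lee_fin vMF_pdf_ge0.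
rewrite preimage_setI [in RHS](_ : _ @^-1` (usphere n) = usphere n); last first.
  by apply/seteqP; split => v; rewrite /usphere /= enorm_mulmx.
by apply: eq_integral => v _; rewrite /vMF_pdf -{4}muM dotv_mulmx.
Qed.

End surface_isometries.

(** * Measures with a density *)

Section density.
Context {d} {T : measurableType d} {R : realType}.
Variables (m Q : {measure set T -> \bar R}) (D : set T) (g : T -> R).
Hypotheses (mD : measurable D) (mg : measurable_fun setT g)
  (g0 : forall x, 0 <= g x).
Hypothesis QE : forall A, measurable A ->
  (Q A = \int[m]_(x in A `&` D) (g x)%:E)%E.

Import HBNNSimple.

Let density_nnsfun (h : {nnsfun T >-> R}) :
  (\int[Q]_x (h x)%:E = \int[m]_(x in D) ((h x)%:E * (g x)%:E))%E.
Proof.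
under [LHS]eq_integral do rewrite fimfunE -fsumEFin//.
rewrite [LHS]ge0_integral_fsum//; last 2 first.
- by move=> r; exact/measurable_EFinP/measurable_funM.
- by move=> r x _; exact: nnfun_muleindic_ge0.
transitivity (\int[m]_(x in D) (\sum_(r \in range h)
    (r * \1_(h @^-1` [set r]) x)%:E * (g x)%:E))%E; last first.
  apply: eq_integral => x _.
  rewrite -ge0_mule_fsuml => [|y]; last exact: nnfun_muleindic_ge0.
  by rewrite fsumEFin// -fimfunE.
rewrite ge0_integral_fsum//; last 2 first.
- move=> r; apply: emeasurable_funM; last exact/measurable_EFinP/measurable_funTS.
  by apply/measurable_EFinP/measurable_funTS; exact: measurable_funM.
- by move=> r x _; rewrite mule_ge0 ?lee_fin//; exact: nnfun_muleindic_ge0.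
apply: eq_fsbigr => r /[!inE] -[x0 _ hx0].
have r0 : 0 <= r by rewrite -hx0.
rewrite integralZl_indic_nnsfun// integral_indic// setIT.
under [RHS]eq_integral do rewrite EFinM -muleA.
rewrite ge0_integralZl//.
- congr (_ * _)%E; rewrite QE//.
  by rewrite integral_mkcondl; apply: eq_integral => x _; rewrite epatch_indic muleC.
- apply: emeasurable_funM; last exact/measurable_EFinP/measurable_funTS.
  by apply/measurable_EFinP/measurable_funTS.
- by move=> x _; rewrite mule_ge0 ?lee_fin.
Qed.

(** The hypothesis [QE] treats indicators and, by linearity, simple functions; monotone convergence
    on both sides then gives all nonnegative [f]. *)
Lemma ge0_integral_density (f : T -> \bar R) :
  measurable_fun setT f -> (forall x, 0 <= f x)%E ->
  (\int[Q]_x f x = \int[m]_(x in D) (f x * (g x)%:E))%E.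
Proof.
move=> mf f0; pose h := nnsfun_approx measurableT mf.
transitivity (lim (\int[Q]_x (h n x)%:E @[n --> \oo]))%E.
  rewrite -monotone_convergence//.
  - by apply: eq_integral => x _; apply/esym/cvg_lim => //; exact: cvg_nnsfun_approx.
  - by move=> n; exact/measurable_EFinP.
  - by move=> n x _; rewrite lee_fin.
  - by move=> x _ a b ab; rewrite lee_fin; exact/lefP/nd_nnsfun_approx.
under eq_fun do rewrite density_nnsfun.
rewrite -monotone_convergence//.
- apply: eq_integral => x _; apply/cvg_lim => //; apply: cvgeZr => //.
  exact: cvg_nnsfun_approx.
- move=> n; apply: emeasurable_funM; apply/measurable_EFinP/measurable_funTS => //.
- by move=> n x _; rewrite mule_ge0 ?lee_fin.
- move=> x _ a b ab; rewrite lee_wpmul2r ?lee_fin//.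
  exact/lefP/nd_nnsfun_approx.
Qed.

End density.

(** * The von Mises-Fisher law *)

Section euclidean_extra.
Context {R : realType} {n : nat}.
Implicit Types u v x : 'rV[R]_n.

Lemma cauchy_schwarz_sq u v : dotv u v ^+ 2 <= dotv u u * dotv v v.
Proof.
have [->|v0] := eqVneq v 0; first by rewrite !dotv0r expr0n mulr0.
have vv : 0 < dotv v v by rewrite lt0r dotv_eq0 v0 dotv_ge0.
(* This vector has squared length [<v,v> (<u,u> <v,v> - <u,v>^2)], and [<v,v>] is positive. *)
have := dotv_ge0 (dotv v v *: u - dotv u v *: v).
rewrite !(dotvDl, dotvDr, dotvNl, dotvNr, dotvZl, dotvZr) (dotvC v u) => h.
rewrite -subr_ge0 -(pmulr_rge0 _ vv); apply: le_trans h _.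
by rewrite le_eqVlt; apply/orP; left; apply/eqP; ring.
Qed.

Lemma cauchy_schwarz u v : `|dotv u v| <= enorm u * enorm v.
Proof.
rewrite -(@ler_pXn2r _ 2)// ?nnegrE// ?mulr_ge0 ?enorm_ge0//.
by rewrite real_normK ?num_real// exprMn !enorm_sq cauchy_schwarz_sq.
Qed.

Lemma exists_orthogonal v : (2 <= n)%N -> exists2 u, u != 0 & dotv u v = 0.
Proof.
case: n v => [|[|m]] // v _; have [v0|v0] := eqVneq (v 0 ord0) 0.
  exists (delta_mx 0 ord0); last by rewrite dotvC dotv_delta.
  apply/eqP => /rowP/(_ ord0); rewrite !mxE /= => /eqP.
  by rewrite oner_eq0.
exists (v 0 ord0 *: delta_mx 0 (lift ord0 ord0) -
        v 0 (lift ord0 ord0) *: delta_mx 0 ord0).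
  apply/eqP => /rowP/(_ (lift ord0 ord0)); rewrite !mxE /= => /eqP.
  by rewrite mulr1 mulr0 subr0 (negbTE v0).
by rewrite dotvC !(dotvDr, dotvNr, dotvZr, dotv_delta) mulrC subrr.
Qed.

Lemma measurable_dotv_eq0 u : measurable [set v | dotv u v = 0].
Proof.
have := @measurable_dotv R n u measurableT [set 0] (measurable_set1 _).
by rewrite setTI.
Qed.

Lemma measurable_fun_addv d (T : measurableType d) (f g : T -> 'rV[R]_n) :
  measurable_fun setT f -> measurable_fun setT g ->
  measurable_fun setT (fun t => f t + g t).
Proof.
move=> /measurable_fun_rVP mf /measurable_fun_rVP mg; apply/measurable_fun_rVP => i.
by under eq_fun do rewrite mxE; exact: measurable_funD.
Qed.

Lemma measurable_fun_scalev d (T : measurableType d) (a : R) (f : T -> 'rV[R]_n) :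
  measurable_fun setT f -> measurable_fun setT (fun t => a *: f t).
Proof.
move=> /measurable_fun_rVP mf; apply/measurable_fun_rVP => i.
by under eq_fun do rewrite mxE; exact: measurable_funM.
Qed.

Lemma measurable_fun_dotv d (T : measurableType d) (f g : T -> 'rV[R]_n) :
  measurable_fun setT f -> measurable_fun setT g ->
  measurable_fun setT (fun t => dotv (f t) (g t)).
Proof.
move=> /measurable_fun_rVP mf /measurable_fun_rVP mg.
by apply: measurable_sum => i; exact: measurable_funM.
Qed.

Lemma measurable_rV_set1 v : measurable [set v].
Proof.
have mB : measurable_fun setT (fun w : 'rV[R]_n => w + (- v)).
  exact: measurable_fun_addv.
have := measurable_fun_dotv mB mB measurableT (measurable_set1 (0 : R)).
rewrite setTI (_ : _ @^-1` _ = [set v])//.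
apply/seteqP; split => w /=; last by move=> ->; rewrite subrr dotv0r.
by move=> /eqP; rewrite dotv_eq0 subr_eq0 => /eqP.
Qed.

End euclidean_extra.

(** A rigid map sends the hyperplane to the one where the first coordinate vanishes, a product with
    the null factor [[set 0]]. *)
Lemma lebesgue_hyperplane (R : realType) n (u : 'rV[R]_n) : u != 0 ->
  lebesgue_rV R n [set v | dotv u v = 0] = 0%E.
Proof.
case: n u => [|m] u u0; first by move: u0; rewrite thinmx0 eqxx.
have [M [MM [_ pM]] uM] := rigid_align u.
pose H0 : set 'rV[R]_m.+1 := [set v | v 0 ord0 = 0].
have mH0 : measurable H0.
  have := @measurable_coord _ R m.+1 ord0 measurableT [set 0] (measurable_set1 _).
  by rewrite setTI.
have -> : [set v | dotv u v = 0] = (mulmx^~ M) @^-1` H0.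
  apply/seteqP; split => v; rewrite /H0 /= -(dotv_mulmx u v MM) uM dotvZl dotvC.
    by rewrite dotv_delta => /eqP; rewrite mulf_eq0 enorm_eq0 (negbTE u0) => /eqP.
  by rewrite dotv_delta => ->; rewrite mulr0.
rewrite pM// lebesgue_rVS (_ : _ @^-1` _ = [set 0] `*` setT); last first.
  apply/seteqP; split => -[x w]; rewrite /H0 /=; last by rewrite consrV0 => -[->].
  by rewrite consrV0.
rewrite product_measure1E// [X in (X * _)%E](_ : _ = 0%E) ?mul0e//.
exact: lebesgue_measure_set1.
Qed.

(** The cone over a hyperplane through 0 lies in that hyperplane. *)
Lemma surface_hyperplane (R : realType) n (u : 'rV[R]_n) : u != 0 ->
  @surface_measure R n [set v | dotv u v = 0] = 0%E.
Proof.
move=> u0; rewrite /surface_measure (_ : lebesgue_rV _ _ _ = 0%E) ?mule0//.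
have mH := measurable_dotv_eq0 u.
apply: (@subset_measure0 _ _ _ _ _ [set v | dotv u v = 0]) => //.
- apply: measurableI; last exact: measurable_punctured_ball.
  by rewrite -[X in measurable X]setTI; exact: measurable_unitize.
- move=> v [/= + /andP[v0 _]]; rewrite /unitize dotvZr => /eqP.
  by rewrite mulf_eq0 invr_eq0 (gt_eqF v0) => /eqP.
- exact: lebesgue_hyperplane.
Qed.

Section von_mises_fisher_law.
Context {R : realType} {n : nat} (mu : 'rV[R]_n) (kappa : R).
Hypotheses (mu1 : usphere n mu) (kappa_gt0 : 0 < kappa).
Variable Q : probability 'rV[R]_n R.
Hypothesis QE : forall A, measurable A -> Q A = vMF mu kappa A.

Local Notation S := (usphere n : set 'rV[R]_n).
Local Notation sigma := (@surface_measure R n).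
Let mS : measurable S := @measurable_usphere R n.
Local Notation K := (vMF_const mu kappa).

Lemma vMF_sphere : Q S = 1%E.
Proof.
by rewrite -(@probability_setT _ _ _ Q) !QE// /vMF setIid setTI.
Qed.

Lemma integral_pdf : (\int[sigma]_(y in S) (vMF_pdf mu kappa y)%:E = 1)%E.
Proof. by rewrite -vMF_sphere QE// /vMF setIid. Qed.

(** A normalizing integral equal to 0 or to infinity would give [K = 0], by the default values of
    [fine] and of the inverse. The density would then vanish, although [Q] has mass 1. *)
Lemma vMF_const_gt0 : 0 < K.
Proof.
rewrite lt0r vMF_const_ge0 andbT; apply/eqP => K0.
have := integral_pdf; rewrite integral0_eq.
  by move/eqP; rewrite eq_sym onee_eq0.
by move=> y _; rewrite /vMF_pdf K0 mul0r.
Qed.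

Lemma vMF_hyperplane u : u != 0 -> Q [set v | dotv u v = 0] = 0%E.
Proof.
move=> u0.
have mH := measurable_dotv_eq0 u.
rewrite QE// /vMF null_set_integral//.
- exact: measurableI.
- by apply/measurable_EFinP/measurable_funTS; exact: measurable_vMF_pdf.
- apply: (@subset_measure0 _ _ _ _ _ [set v | dotv u v = 0]) => //.
  + exact: measurableI.
  + exact: surface_hyperplane.
Qed.

Lemma vMF_atomless v : (2 <= n)%N -> Q [set v] = 0%E.
Proof.
move=> /(exists_orthogonal v)[u u0 uv].
apply: (@subset_measure0 _ _ _ _ _ [set y | dotv u y = 0]).
- exact: measurable_rV_set1.
- exact: measurable_dotv_eq0.
- by move=> _ ->.
- exact: vMF_hyperplane.
Qed.

(** Integrals are taken over the sphere, of full mass, because the integrands at hand are bounded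
    there but not on the whole space. *)
Lemma integrable_sphere (f : 'rV[R]_n -> R) (B : R) : measurable_fun setT f ->
  (forall y, S y -> `|f y| <= B) -> Q.-integrable S (EFin \o f).
Proof.
move=> mf fB; apply: measurable_bounded_integrable => //.
- by rewrite -ge0_fin_numE// fin_num_measure.
- exact: measurable_funTS.
- exists B; split; first exact: num_real.
  by move=> M BM y Sy /=; apply: le_trans (ltW BM); exact: fB.
Qed.

Lemma integrable_dotv u : Q.-integrable S (EFin \o dotv u).
Proof.
apply: (@integrable_sphere _ (enorm u)); first exact: measurable_dotv.
by move=> y Sy; rewrite (le_trans (cauchy_schwarz _ _))// Sy mulr1.
Qed.

Lemma Rintegral_rigid M f : rigid M -> mu *m M = mu -> measurable_fun setT f ->
  Q.-integrable S (EFin \o (fun y => f (y *m M))) ->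
  \int[Q]_(y in S) f y = \int[Q]_(y in S) f (y *m M).
Proof.
move=> isoM muM mf intf; have [MM _] := isoM.
have preS : (mulmx^~ M) @^-1` S = S.
  by apply/seteqP; split => v; rewrite /usphere /= enorm_mulmx.
rewrite /Rintegral; congr fine.
have mM := measurable_mulmxr M.
have := @integral_pushforward _ _ _ _ _ _ mM Q S (EFin \o f).
rewrite preS => <- //; last exact/measurable_EFinP.
apply: eq_measure_integral => A mA _.
suff : Q A = Q ((mulmx^~ M) @^-1` A) by [].
rewrite !QE//; first by rewrite vMF_rigid.
by rewrite -[X in measurable X]setTI; exact: mM.
Qed.

(** The scalar [c] for which the law has mean [c mu], as [mean_dotv] shows. *)
Definition mean_length : R := \int[Q]_(y in S) dotv mu y.

(** The reflection along [v] fixes [mu], hence the law, and changes the sign of the integrand; the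
    integral equals its own opposite. *)
Lemma mean_orthogonal v : dotv v mu = 0 -> \int[Q]_(y in S) dotv v y = 0.
Proof.
move=> vmu; have [->|v0] := eqVneq v 0.
  under eq_Rintegral do rewrite dotvC dotv0r.
  by rewrite Rintegral_cst// mul0r.
have vv : dotv v v != 0 by rewrite dotv_eq0.
have dotH y : dotv v (y *m householder_mx v) = (- 1) * dotv v y.
  by rewrite mul_householder_mx dotvDr dotvNr dotvZr (dotvC y v); field.
have : \int[Q]_(y in S) dotv v y = - \int[Q]_(y in S) dotv v y.
  rewrite [LHS](Rintegral_rigid (rigid_householder v0)).
  - under eq_Rintegral do rewrite dotH.
    by rewrite RintegralZl ?mulN1r//; exact: integrable_dotv.
  - by rewrite mul_householder_mx dotvC vmu mulr0 mul0r scale0r subr0.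
  - exact: measurable_dotv.
  - apply: (@integrable_sphere _ (enorm v)).
      under eq_fun do rewrite dotH.
      by apply: measurable_funM => //; exact: measurable_dotv.
    move=> y Sy; rewrite dotH mulN1r normrN.
    by rewrite (le_trans (cauchy_schwarz _ _))// Sy mulr1.
lra.
Qed.

Lemma mean_dotv u : \int[Q]_(y in S) dotv u y = mean_length * dotv u mu.
Proof.
have mumu : dotv mu mu = 1 by apply/usphereP.
pose v := u - dotv u mu *: mu.
have uE y : dotv u y = dotv (dotv u mu *: mu) y + dotv v y.
  by rewrite /v dotvDl dotvNl addrC subrK.
under eq_Rintegral do rewrite uE.
rewrite RintegralD//; [|exact: integrable_dotv..].
have vmu : dotv v mu = 0 by rewrite /v dotvDl dotvNl dotvZl mumu mulr1 subrr.
rewrite (mean_orthogonal vmu) addr0.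
under eq_Rintegral do rewrite dotvZl.
by rewrite RintegralZl 1?mulrC//; exact: integrable_dotv.
Qed.

Lemma Rintegral_sphere_cst (r : R) : \int[Q]_(y in S) r = r.
Proof.
rewrite Rintegral_cst// -[RHS]mulr1; congr (_ * _).
by rewrite -[RHS]/(fine 1%E); congr fine; exact: vMF_sphere.
Qed.

Lemma ge0_integral_sphere (f : 'rV[R]_n -> \bar R) : measurable_fun setT f ->
  (forall y, 0 <= f y)%E -> (\int[Q]_y f y = \int[Q]_(y in S) f y)%E.
Proof.
move=> mf f0; have QCS : Q (~` S) = 0%E by rewrite probability_setC// vMF_sphere subee.
rewrite (@ge0_negligible_integral _ _ _ _ _ (~` S))//.
- by rewrite setTD setCK.
- exact: measurableC.
Qed.

Lemma measurable_expR_dotv (a : R) u :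
  measurable_fun setT (fun y : 'rV[R]_n => expR (a * dotv u y)).
Proof.
apply: measurableT_comp => //.
by apply: measurable_funM => //; exact: measurable_dotv.
Qed.

(** The integrand times the density at [y] is the density at the reflection of [y] along [mu], and
    this reflection preserves the surface measure. *)
Lemma integral_expR_mean :
  (\int[Q]_(y in S) (expR (- (2 * kappa) * dotv mu y))%:E = 1)%E.
Proof.
have mexp := measurable_expR_dotv (- (2 * kappa)) mu.
rewrite -ge0_integral_sphere; last 2 first.
- exact/measurable_EFinP.
- by move=> y; rewrite lee_fin expR_ge0.
have mumu : dotv mu mu = 1 by apply/usphereP.
have mu0 : mu != 0 by rewrite -dotv_eq0 mumu oner_eq0.
have isoH := rigid_householder mu0; have [HH _] := isoH.
have dotH y : dotv mu (y *m householder_mx mu) = - dotv mu y.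
  by rewrite mul_householder_mx dotvDr dotvNr dotvZr mumu (dotvC y mu); field.
rewrite (@ge0_integral_density _ _ _ sigma _ S (vMF_pdf mu kappa)) => //.
- rewrite -[RHS]integral_pdf [RHS](ge0_integral_rigid isoH)//; last 2 first.
  + by apply/measurable_EFinP; exact: measurable_vMF_pdf.
  + by move=> y; rewrite lee_fin vMF_pdf_ge0.
  rewrite [in RHS](_ : _ @^-1` S = S); last first.
    by apply/seteqP; split => v; rewrite /usphere /= enorm_mulmx.
  apply: eq_integral => y _; rewrite -EFinM; congr EFin.
  rewrite /vMF_pdf dotH mulrCA -expRD; congr (_ * expR _); ring.
- exact: measurable_vMF_pdf.
- by move=> y; exact: vMF_pdf_ge0.
- exact/measurable_EFinP.
Qed.

(* By reflection the integral of exp(- 2 kappa <mu, y>) is 1, so convexity of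
   the exponential gives a nonnegative mean length, and strict convexity
   together with the negligibility of hyperplanes makes it positive. *)
Lemma mean_length_gt0 : 0 < mean_length.
Proof.
have mumu : dotv mu mu = 1 by apply/usphereP.
have mu0 : mu != 0 by rewrite -dotv_eq0 mumu oner_eq0.
(* With [x = - 2 kappa <mu, y>], the sum [e y + l y] is [exp x - 1 - x]: nonnegative, and zero only
   at [x = 0]. *)
pose e y := expR (- (2 * kappa) * dotv mu y).
pose l y := dotv (2 * kappa *: mu) y - 1.
have me : measurable_fun setT e := measurable_expR_dotv _ _.
have ml : measurable_fun setT l.
  by apply: measurable_funB => //; exact: measurable_dotv.
have phi0 y : 0 <= e y + l y.
  by have := expR_ge1Dx (- (2 * kappa) * dotv mu y); rewrite /e /l dotvZl; lra.
have phi_eq0 y : e y + l y = 0 -> dotv mu y = 0.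
  move=> ely; apply/eqP/negP => /negP muy.
  have : - (2 * kappa) * dotv mu y != 0.
    by rewrite mulf_neq0// oppr_eq0 gt_eqF// mulr_gt0.
  move=> /expR_gt1Dx; move: ely; rewrite /e /l dotvZl; lra.
have dB y : S y -> `|dotv mu y| <= 1.
  by move=> Sy; rewrite (le_trans (cauchy_schwarz _ _))// Sy mu1 mulr1.
have ie : Q.-integrable S (EFin \o e).
  apply: (@integrable_sphere _ (expR (2 * kappa))) => // y Sy.
  rewrite ger0_norm ?expR_ge0// ler_expR.
  have := dB y Sy; rewrite ler_norml => /andP[h _].
  have : 0 <= kappa * (dotv mu y + 1) by apply: mulr_ge0; [exact: ltW|lra].
  lra.
have ione : Q.-integrable S (EFin \o cst 1).
  by apply: (@integrable_sphere _ 1) => // y _; rewrite normr1.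
have il : Q.-integrable S (EFin \o l).
  apply: (@integrable_sphere _ (2 * kappa + 1)) => // y Sy.
  rewrite (le_trans (ler_normB _ _))// normr1 lerD2r dotvZl normrM.
  rewrite gtr0_norm ?mulr_gt0//; apply: ler_piMr; last exact: dB.
  by apply: mulr_ge0 => //; exact: ltW.
rewrite ltNge; apply/negP => c_le0.
(* The integral of [e + l] is [1 + 2 kappa c - 1 = 2 kappa c], where [c] is the mean length, assumed
   here to be at most 0. *)
have : (\int[Q]_(y in S) `|(e y + l y)%:E| = 0)%E.
  have -> : (\int[Q]_(y in S) `|(e y + l y)%:E| =
      \int[Q]_(y in S) (e y + l y)%:E)%E.
    by apply: eq_integral => y _; rewrite gee0_abs// lee_fin.
  apply/eqP; rewrite eq_le integral_ge0 ?andbT; last by move=> y _; rewrite lee_fin.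
  rewrite -[leLHS]fineK; last first.
    apply: integrable_fin_num => //.
    have -> : (fun y => (e y + l y)%:E) = (EFin \o e) \+ (EFin \o l) by [].
    exact: integrableD.
  rewrite lee_fin -[leLHS]/(\int[Q]_(y in S) (e y + l y)) RintegralD//.
  rewrite {1}/Rintegral integral_expR_mean /= RintegralB//; last exact: integrable_dotv.
  rewrite Rintegral_sphere_cst mean_dotv dotvZl mumu mulr1.
  by have : 0 < kappa by []; nra.
move=> /ae_eq_integral_abs[]//.
  by apply/measurable_EFinP/measurable_funTS; exact: measurable_funD.
move=> N [mN QN SN].
(* The sphere would be covered by the null set [N] and the null hyperplane [H]. *)
have : Q S = 0%E.
  pose H := [set y | dotv mu y = 0].
  have mH : measurable H := measurable_dotv_eq0 mu.
  apply: (@subset_measure0 _ _ _ _ _ (N `|` H)) => //.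
  - exact: measurableU.
  - move=> y Sy; have [Ny|/contrapT ely] := pselect (~ (e y + l y = 0)).
      by left; apply: SN => /(_ Sy)[].
    by right; exact: phi_eq0.
  - by rewrite [LHS](measureU0 mN mH)//; exact: vMF_hyperplane.
by rewrite vMF_sphere => /eqP; rewrite onee_eq0.
Qed.

(** The cross term vanishes since [y - m] is centered. The shift [w] stands for the deviation
    accumulated by earlier observations. *)
Lemma second_moment (w : 'rV[R]_n) (m := mean_length *: mu) :
  (\int[Q]_y (dotv (w + (y - m)) (w + (y - m)))%:E =
   (dotv w w + (1 - mean_length ^+ 2))%:E)%E.
Proof.
have mumu : dotv mu mu = 1 by apply/usphereP.
have mB : measurable_fun setT (fun y : 'rV[R]_n => w + (y - m)).
  by do 2!apply: measurable_fun_addv => //.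
rewrite ge0_integral_sphere; last 2 first.
- by apply/measurable_EFinP; exact: measurable_fun_dotv.
- by move=> y; rewrite lee_fin dotv_ge0.
pose a := dotv (w - m) (w - m) + 1.
(* On the sphere [<y, y> = 1], so the integrand is affine in [y] and [mean_dotv] evaluates it. *)
transitivity (\int[Q]_(y in S) (a + dotv (2 *: (w - m)) y)%:E)%E.
  apply: eq_integral => y /[!inE] /usphereP yy; congr EFin.
  rewrite /a; move: (m) => x; rewrite !(dotvDl, dotvDr, dotvNl, dotvNr, dotvZl) yy.
  by rewrite (dotvC y w) (dotvC y x) (dotvC x w); ring.
have ia : Q.-integrable S (EFin \o cst a).
  by apply: (@integrable_sphere _ `|a|).
have id := integrable_dotv (2 *: (w - m)).
rewrite -[LHS]fineK; last first.
  apply: integrable_fin_num => //.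
  have -> : (fun y => (a + dotv (2 *: (w - m)) y)%:E) =
    (EFin \o cst a) \+ (EFin \o dotv (2 *: (w - m))) by [].
  exact: integrableD.
congr EFin; rewrite -[LHS]/(\int[Q]_(y in S) (a + dotv (2 *: (w - m)) y)).
rewrite RintegralD// mean_dotv Rintegral_sphere_cst /a /m.
rewrite !(dotvDl, dotvDr, dotvNl, dotvNr, dotvZl, dotvZr) mumu (dotvC mu w).
by ring.
Qed.

End von_mises_fisher_law.

(** * Maximum likelihood and independence *)

Section maximum_likelihood.
Context {R : realType} {n : nat}.
Implicit Types (mu nu : 'rV[R]_n) (kappa : R) (s : seq 'rV[R]_n).

Lemma log_likelihoodE kappa s nu : 0 < vMF_const nu kappa ->
  log_likelihood kappa s nu =
  (size s)%:R * ln (vMF_const nu kappa) + kappa * dotv nu (\sum_(z <- s) z).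
Proof.
move=> K0; rewrite /log_likelihood dotv_sumr mulr_sumr.
under eq_bigr do rewrite /vMF_pdf lnM ?posrE ?expR_gt0// expRK.
by rewrite big_split /= big_const_seq count_predT iter_addr_0 mulr_natl.
Qed.

(** The strict case of Cauchy-Schwarz, from expanding [|nu - mu|^2 > 0]; it yields uniqueness of the
    maximizer. *)
Lemma dotv_lt1 mu nu : usphere n mu -> usphere n nu -> nu != mu ->
  dotv nu mu < 1.
Proof.
move=> /usphereP mu1 /usphereP nu1 numu.
have : 0 < dotv (nu - mu) (nu - mu) by rewrite lt0r dotv_ge0 dotv_eq0 subr_eq0 numu.
rewrite !(dotvDl, dotvDr, dotvNl, dotvNr) mu1 nu1 (dotvC mu nu); lra.
Qed.

Lemma is_MLE_unitize_smean kappa s mu : usphere n mu -> 0 < kappa ->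
  0 < vMF_const mu kappa -> smean s != 0 -> is_MLE kappa s (unitize (smean s)).
Proof.
move=> mu1 kappa0 K0 r0; have hat1 := unitize_sphere r0; split => // nu nu1 nuhat.
have K_gt0 x : usphere n x -> 0 < vMF_const x kappa.
  by move=> x1; rewrite (vMF_const_unif _ x1 mu1).
rewrite !log_likelihoodE ?K_gt0// (vMF_const_unif _ nu1 hat1).
rewrite ltrD2l ltr_pM2l//.
(* An empty sample has [smean] equal to 0, since the inverse of 0 is 0. *)
have size0 : (size s)%:R != 0 :> R.
  by apply: contraNneq r0 => s0; rewrite /smean s0 invr0 scale0r.
have e0 : 0 < enorm (smean s) by rewrite enorm_gt0.
have -> : \sum_(z <- s) z = ((size s)%:R * enorm (smean s)) *: unitize (smean s).
  rewrite /unitize scalerA mulfK ?gt_eqF//.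
  by rewrite /smean scalerA mulfV// scale1r.
rewrite !(dotvZr _ (unitize _)) ltr_pM2l; last by rewrite mulr_gt0// lt0r size0 ler0n.
by have /usphereP -> := hat1; exact: dotv_lt1.
Qed.

End maximum_likelihood.

(** * Independence of a partial sum from the next observation *)

Section independence.
Context {d} {Omega : measurableType d} {R : realType} {n : nat}.
Variables (P : probability Omega R) (z : nat -> {RV P >-> 'rV[R]_n}).
Hypothesis indz : mutually_independent z.

(** Cylinder events: a class stable under intersection that generates the sigma-algebra of the [z j]
    with [j] in [J]. *)
Let past (J : {fset nat}) : set (set Omega) :=
  [set E | exists A : nat -> set 'rV[R]_n, (forall j, measurable (A j)) /\
    E = \bigcap_(j in [set` J]) z j @^-1` A j].

Let past_measurable J : past J `<=` measurable.
Proof.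
move=> _ [A [mA ->]]; apply: fin_bigcap_measurable => // j _.
by rewrite -[X in measurable X]setTI; exact: measurable_funPT.
Qed.

(** With [F] the event that [z k] lies in [B], the finite measures sending [E] to [P (E & F)] and to
    [P E * P F] agree on cylinders, hence on the generated sigma-algebra. *)
Let past_independent (J : {fset nat}) k B E : k \notin J -> measurable B ->
  <<s past J >> E -> P (E `&` z k @^-1` B) = (P E * P (z k @^-1` B))%E.
Proof.
move=> kJ mB sE.
have mzB : measurable (z k @^-1` B).
  by rewrite -[X in measurable X]setTI; exact: measurable_funPT.
pose r : {nonneg R} := NngNum (fine_ge0 (measure_ge0 P (z k @^-1` B))).
have rE : r%:num%:E = P (z k @^-1` B) by rewrite /= fineK// fin_num_measure.
transitivity (mrestr P mzB E) => //.
transitivity (mscale r P E); last by rewrite /mscale rE muleC.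
have pT : past J setT by exists (fun _ => setT); rewrite bigcapT.
have pI : setI_closed (past J).
  move=> _ _ [A [mA ->]] [C [mC ->]]; exists (fun j => A j `&` C j).
  by split => [j|]; [exact: measurableI|rewrite -bigcapI].
have cover : \bigcup_(i in [set: nat]) [set: Omega] = setT by rewrite bigcup_const.
apply: (@g_sigma_algebra_measure_unique _ R Omega (past J) (@past_measurable J)
  (fun _ => setT) (fun _ => pT) cover (mrestr P mzB) (mscale r P) pI) => //.
- move=> _ [A [mA ->]].
  pose A' j := if j == k then B else A j.
  have mA' j : measurable (A' j) by rewrite /A'; case: eqP.
  have A'E : \bigcap_(j in [set` J]) z j @^-1` A j =
             \bigcap_(j in [set` J]) z j @^-1` A' j.
    apply: eq_bigcapr => j /= jJ; rewrite /A' ifN//.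
    by apply: contraNneq kJ => <-.
  have := indz (k |` J)%fset mA'.
  rewrite bigcap_fsetU1 big_fsetU1//= [A' k]/A' eqxx -A'E setIC.
  rewrite /mrestr /mscale /= => ->.
  by rewrite -(indz _ mA') -A'E rE.
- move=> _; apply: (@le_lt_trans _ _ 1%E); last exact: ltry.
  by apply: probability_le1; exact: measurableI.
Qed.

Definition partial_sum k (w : Omega) : 'rV[R]_n := \sum_(i < k) z i w.

Lemma partial_sum0 : partial_sum 0 = cst 0.
Proof. by apply/funext => w; exact: big_ord0. Qed.

Lemma partial_sumS k : partial_sum k.+1 = fun w => partial_sum k w + z k w.
Proof. by apply/funext => w; rewrite /partial_sum big_ord_recr. Qed.

Lemma measurable_partial_sum k : measurable_fun setT (partial_sum k).
Proof.
elim: k => [|k IHk].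
  by rewrite partial_sum0; exact: measurable_cst.
rewrite partial_sumS.
by apply: measurable_fun_addv => //; exact: measurable_funPT.
Qed.

Let first (k : nat) : {fset nat} := [fset i in iota 0 k]%fset.

Let in_first k i : (i \in first k) = (i < k)%N.
Proof. by rewrite in_fset /= mem_iota. Qed.

(** The bound [K] is separate from [k] so that the induction stays within one sigma-algebra. [T'] is
    [Omega] with that sigma-algebra, where sums of measurable maps are measurable. *)
Let partial_sum_past K k B : (k <= K)%N -> measurable B ->
  <<s past (first K) >> (partial_sum k @^-1` B).
Proof.
move=> kK mB; pose T' := g_sigma_algebraType (past (first K)).
suff : measurable_fun [set: T'] (partial_sum k : T' -> 'rV[R]_n).
  by move=> /(_ measurableT B mB); rewrite setTI.
elim: k kK => [|k IHk] kK.
  by rewrite partial_sum0; exact: measurable_cst.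
rewrite partial_sumS.
apply: (@measurable_fun_addv R n _ T'); first by apply: IHk; exact: ltnW.
move=> _ C mC; rewrite setTI; apply: sub_sigma_algebra.
exists (fun j => if j == k then C else setT); split; first by move=> j; case: ifP.
apply/seteqP; split => w /=; last first.
  by move=> /(_ k); rewrite /= eqxx in_first; exact.
by move=> Cw j _ /=; case: eqP => [->|].
Qed.

Lemma independent_partial_sum k A B : measurable A -> measurable B ->
  P (partial_sum k @^-1` A `&` z k @^-1` B) =
  (P (partial_sum k @^-1` A) * P (z k @^-1` B))%E.
Proof.
move=> mA mB; apply: (@past_independent (first k)) => //.
  by rewrite in_first ltnn.
exact: partial_sum_past.
Qed.

Definition partial_sum_RV k : {RV P >-> 'rV[R]_n} :=
  HB.pack (partial_sum k) (isMeasurableFun.Build _ _ _ _ _ (measurable_partial_sum k)).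

(** The joint law of the partial sum and the next observation agrees with the product of their laws
    on rectangles, hence everywhere; Tonelli's theorem then applies. *)
Lemma ge0_integral_partial_sumS k (f : 'rV[R]_n -> 'rV[R]_n -> \bar R) :
  measurable_fun setT (fun p : 'rV[R]_n * 'rV[R]_n => f p.1 p.2) ->
  (forall x y, 0 <= f x y)%E ->
  (\int[P]_w f (partial_sum k w) (z k w) =
   \int[P]_w \int[distribution P (z k)]_y f (partial_sum k w) y)%E.
Proof.
move=> mf f0.
have mpair : measurable_fun setT (fun w => (partial_sum k w, z k w)).
  by apply/measurable_fun_pair; [exact: measurable_partial_sum|exact: measurable_funPT].
pose F (p : 'rV[R]_n * 'rV[R]_n) := f p.1 p.2.
pose m1 := distribution P (partial_sum_RV k); pose m2 := distribution P (z k).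
have F0 p : (0 <= F p)%E by exact: f0.
rewrite -[LHS]/(\int[P]_(w in (fun w => (partial_sum k w, z k w)) @^-1` setT)
  (F \o (fun w => (partial_sum k w, z k w))) w)%E.
rewrite -(@ge0_integral_pushforward _ _ _ _ _ _ mpair P setT F)//.
transitivity (\int[m1 \x m2]_p F p)%E.
  apply: eq_measure_integral => C mC _; apply/esym/product_measure_unique => //.
  move=> A B mA mB; exact: independent_partial_sum.
rewrite fubini_tonelli1//.
rewrite /m1 ge0_integral_distribution//.
- exact: measurable_fun_fubini_tonelli_F.
- by move=> x; apply: integral_ge0 => y _.
Qed.

End independence.

(** * Consistency *)

(** A quantitative continuity of normalization at [c mu], valid for every [r]. It reflects
    [|c h - c mu| <= |c h - r| + |r - c mu|] for [h = unitize r], where the first term is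
    [| |r| - c |], at most the second. *)
Lemma unitize_close (R : realType) n (r mu : 'rV[R]_n) (c : R) :
  usphere n mu -> 0 < c ->
  c ^+ 2 * dotv (unitize r - mu) (unitize r - mu) <=
  4 * dotv (r - c *: mu) (r - c *: mu).
Proof.
move=> /[dup] mu_sphere /usphereP mumu c0.
have [->|r0] := eqVneq r 0.
  rewrite /unitize scaler0 !sub0r !(dotvNl, dotvNr, dotvZl, dotvZr) mumu.
  by have := sqr_ge0 c; rewrite expr2; lra.
have h1 := unitize_sphere r0; have /usphereP hh := h1.
have rE : r = enorm r *: unitize r.
  by rewrite /unitize scalerA mulfV ?scale1r// enorm_eq0.
have p0 := enorm_ge0 r; move: (enorm r) rE p0 => p rE p0.
move: (unitize r) h1 hh rE => h h1 hh ->.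
have := cauchy_schwarz h mu; rewrite h1 mu_sphere mulr1 ler_norml => /andP[t1 t2].
rewrite !(dotvDl, dotvDr, dotvNl, dotvNr, dotvZl, dotvZr) mumu hh (dotvC mu h).
move: (dotv h mu) t1 t2 => t t1 t2.
(* With [p = |r|] and [t = <h, mu>], the right side minus the left is
   [4 (p - c t)^2 + 2 c^2 (1 - t) (1 + 2 t)], and also [4 p^2 - 8 c p t + 2 c^2 (1 + t)]; each form
   suits one sign of [t]. *)
have [t0|t0] := leP 0 t.
  have h1' : 0 <= 4 * (p - c * t) ^+ 2 by rewrite mulr_ge0// sqr_ge0.
  have h2' : 0 <= 2 * c ^+ 2 * ((1 - t) * (1 + 2 * t)).
    apply: mulr_ge0; first by rewrite mulr_ge0// sqr_ge0.
    by apply: mulr_ge0; lra.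
  by lra.
have h1' : 0 <= 4 * p ^+ 2 by rewrite mulr_ge0// sqr_ge0.
have h2' : 0 <= 8 * (c * p) * (- t).
  apply: mulr_ge0; last by lra.
  by rewrite !mulr_ge0// ltW.
have h3' : 0 <= 2 * c ^+ 2 * (1 + t).
  apply: mulr_ge0; last by lra.
  by rewrite mulr_ge0// sqr_ge0.
by lra.
Qed.

Section consistency.
Context {R : realType} {d : nat} (mu : 'rV[R]_d) (kappa : R).
Hypotheses (d_ge2 : (2 <= d)%N) (mu_unit : usphere d mu) (kappa_gt0 : 0 < kappa).
Context {disp} {Omega : measurableType disp}.
Variables (P : probability Omega R) (z : nat -> {RV P >-> 'rV[R]_d}).
Hypothesis z_iid : iid z (vMF mu kappa).

Let Q : probability 'rV[R]_d R := distribution P (z 0).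

Let indz : mutually_independent z := proj1 z_iid.

Let QE k A : measurable A -> distribution P (z k) A = vMF mu kappa A.
Proof. by move=> mA; exact: (proj2 z_iid). Qed.

Let c := mean_length mu Q.

Let c_gt0 : 0 < c.
Proof. exact: (mean_length_gt0 mu_unit kappa_gt0 (QE 0)). Qed.

Lemma smean_sample k w :
  smean [seq z i w | i <- iota 0 k] = k%:R^-1 *: partial_sum z k w.
Proof.
rewrite /smean size_map size_iota big_map; congr (_ *: _).
by rewrite /partial_sum -[iota 0 k]/(iota 0 k) -{1}(subn0 k) -/(index_iota 0 k) big_mkord.
Qed.

Lemma partial_sum_neq0 k : P [set w | partial_sum z k.+1 w = 0] = 0%E.
Proof.
have mS0 : measurable [set w | partial_sum z k.+1 w = 0].
  have := measurable_partial_sum z k.+1 measurableT (measurable_rV_set1 0).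
  by rewrite setTI.
transitivity (\int[P]_w (\1_[set 0] (partial_sum z k w + z k w))%:E)%E.
  rewrite -[X in P X]setIT -(integral_indic P measurableT mS0).
  by apply: eq_integral => w _; rewrite !indicE partial_sumS.
rewrite (@ge0_integral_partial_sumS _ _ _ _ _ _ indz k
  (fun x y => (\1_[set 0] (x + y))%:E)); last 2 first.
- apply/measurable_EFinP; apply: measurableT_comp.
    by apply: measurable_indic; exact: measurable_rV_set1.
  by apply: measurable_fun_addv; [exact: measurable_fst|exact: measurable_snd].
- by move=> x y; rewrite lee_fin.
rewrite integral0_eq// => w _.
(* For a fixed partial sum, only one value of the last observation makes the total vanish. *)
transitivity (\int[distribution P (z k)]_y (\1_[set - partial_sum z k w] y)%:E)%E.
  apply: eq_integral => y _; rewrite !indicE; congr (_%:R%:E); congr nat_of_bool.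
  apply/idP/idP; rewrite !inE /=; last by move=> ->; rewrite subrr.
  by move=> /eqP; rewrite addrC addr_eq0 => /eqP.
rewrite integral_indic//; last exact: measurable_rV_set1.
rewrite setIT; exact: (vMF_atomless (QE k)).
Qed.

Let D k w : 'rV[R]_d := partial_sum z k w - k%:R *: (c *: mu).

Let mD k : measurable_fun setT (D k).
Proof. by apply: measurable_fun_addv => //; exact: measurable_partial_sum. Qed.

(** By [second_moment] with the current deviation as shift, each observation adds [1 - c^2], which
    is at most 1. *)
Lemma deviation_sq_le k : (\int[P]_w (dotv (D k w) (D k w))%:E <= k%:R%:E)%E.
Proof.
elim: k => [|k IHk].
  rewrite integral0_eq// => w _.
  by rewrite /D partial_sum0 scale0r subr0 dotv0r.
pose f (x y : 'rV[R]_d) : \bar R := (dotv (x - k%:R *: (c *: mu) + (y - c *: mu))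
  (x - k%:R *: (c *: mu) + (y - c *: mu)))%:E.
have -> : (\int[P]_w (dotv (D k.+1 w) (D k.+1 w))%:E =
    \int[P]_w f (partial_sum z k w) (z k w))%E.
  apply: eq_integral => w _; rewrite /f /D partial_sumS.
  suff -> : partial_sum z k w + z k w - k.+1%:R *: (c *: mu) =
    partial_sum z k w - k%:R *: (c *: mu) + (z k w - c *: mu) by [].
  by rewrite -natr1 scalerDl scale1r opprD addrACA.
rewrite (ge0_integral_partial_sumS indz); last 2 first.
- have mfst : measurable_fun setT
      (fun p : 'rV[R]_d * 'rV[R]_d => p.1 - k%:R *: (c *: mu)).
    by apply: measurable_fun_addv => //; exact: measurable_fst.
  have msnd : measurable_fun setT (fun p : 'rV[R]_d * 'rV[R]_d => p.2 - c *: mu).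
    by apply: measurable_fun_addv => //; exact: measurable_snd.
  by apply/measurable_EFinP/measurable_fun_dotv; exact: measurable_fun_addv.
- by move=> x y; rewrite lee_fin dotv_ge0.
have -> : (\int[P]_w \int[distribution P (z k)]_y f (partial_sum z k w) y =
    \int[P]_w (dotv (D k w) (D k w) + (1 - c ^+ 2))%:E)%E.
  apply: eq_integral => w _; rewrite -(second_moment mu_unit (QE 0)).
  apply: eq_measure_integral => A mA _.
  by transitivity (vMF mu kappa A); [exact: QE|exact/esym/(QE 0)].
(* This number is the second moment at shift 0, hence nonnegative. *)
have c_le1 : 0 <= 1 - c ^+ 2.
  have := second_moment mu_unit (QE 0) 0; rewrite dotv0r add0r => h.
  by rewrite -lee_fin -h; apply: integral_ge0 => y _; rewrite lee_fin dotv_ge0.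
have mDD : measurable_fun setT (fun w => dotv (D k w) (D k w)).
  exact: measurable_fun_dotv.
apply: (@le_trans _ _ (\int[P]_w ((dotv (D k w) (D k w))%:E + 1))%E).
  apply: ge0_le_integral => //.
  - by move=> w _; rewrite lee_fin addr_ge0 ?dotv_ge0.
  - by apply/measurable_EFinP; exact: measurable_funD.
  - by apply: emeasurable_funD => //; exact/measurable_EFinP.
  - by move=> w _; rewrite -EFinD lee_fin lerD2l gerBl sqr_ge0.
rewrite ge0_integralD//; last 2 first.
- by move=> w _; rewrite lee_fin dotv_ge0.
- exact/measurable_EFinP.
rewrite -natr1 EFinD; apply: leeD => //.
by rewrite integral_cst// mul1e probability_le1.
Qed.

Lemma muhat_cvg :
  cvg_in_probability P (fun k w => unitize (smean [seq z i w | i <- iota 0 k])) mu.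
Proof.
have -> : (fun k w => unitize (smean [seq z i w | i <- iota 0 k])) =
    (fun k w => unitize (k%:R^-1 *: partial_sum z k w)).
  by apply/funext => k; apply/funext => w; rewrite smean_sample.
(* Shifting the index keeps the sample size positive in the divisions below. *)
move=> eps eps0; rewrite -cvg_shiftS.
pose C := 4 / (c ^+ 2 * eps ^+ 2).
have h0 : (C * k.+1%:R^-1)%:E @[k --> \oo] --> 0%E.
  apply: cvg_EFin; first exact: nearW.
  rewrite -[X in _ --> X](mulr0 C); apply: cvgMr; exact: cvg_harmonic.
have f0 : 0%E @[k --> \oo] --> (0%E : \bar R) by exact: cvg_cst.
apply: (squeeze_cvge _ f0 h0).
apply: nearW => k; rewrite measure_ge0 /=.
  (* For sample size [m], [unitize_close] shows that an error of at least [eps] forces a squared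
     deviation of the sum of at least [delta]. Markov's inequality bounds this event by
     [m / delta = C / m]. *)
  pose delta := (c * eps * k.+1%:R) ^+ 2 / 4.
  have delta0 : 0 < delta by rewrite divr_gt0// exprn_gt0// !mulr_gt0.
  have mDD : measurable_fun setT (fun w => (dotv (D k.+1 w) (D k.+1 w))%:E).
    by apply/measurable_EFinP; exact: measurable_fun_dotv.
  have := le_integral_abse P measurableT mDD delta0.
  set A := _ `&` _ => hA.
  have {hA} : (delta%:E * P A <= k.+1%:R%:E)%E.
    apply: le_trans hA _; apply: le_trans (deviation_sq_le k.+1).
    by under eq_integral do rewrite gee0_abs ?lee_fin ?dotv_ge0//.
  rewrite muleC -lee_pdivlMr// => hA.
  have -> : C * k.+1%:R^-1 = k.+1%:R / delta.
    by rewrite /C /delta; field; rewrite !gt_eqF// ltr0n.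
  apply: le_trans hA; apply: le_measure; rewrite ?inE.
  + have mr : measurable_fun setT
        (fun w => unitize (k.+1%:R^-1 *: partial_sum z k.+1 w) + - mu).
      apply: measurable_fun_addv => //; apply: (measurableT_comp measurable_unitize).
      apply: measurable_fun_scalev; exact: measurable_partial_sum.
    have me := measurableT_comp measurable_enorm mr.
    have := me measurableT `[eps, +oo[%classic (measurable_itv _).
    rewrite setTI; congr (measurable _); apply/seteqP.
    by split => w /=; rewrite in_itv /= andbT.
  + by apply: emeasurable_fun_c_infty => //; exact: measurableT_comp.
  + move=> w epsw; split => //; rewrite /mkset gee0_abs ?lee_fin ?dotv_ge0//.
    have := unitize_close (k.+1%:R^-1 *: partial_sum z k.+1 w) mu_unit c_gt0.
    have DE : D k.+1 w = k.+1%:R *: (k.+1%:R^-1 *: partial_sum z k.+1 w - c *: mu).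
      by rewrite scalerBr scalerA mulfV ?scale1r// pnatr_eq0.
    rewrite DE dotvZl dotvZr -enorm_sq.
    move: epsw; rewrite /mkset; set x := enorm _; set y := dotv _ _ => epsx hxy.
    have K0 : 0 <= k.+1%:R ^+ 2 :> R by exact: sqr_ge0.
    have ex : eps ^+ 2 <= x ^+ 2.
      by rewrite ler_pXn2r// nnegrE; [exact: ltW|exact: enorm_ge0].
    have {}hxy : c ^+ 2 * eps ^+ 2 <= 4 * y.
      by apply: le_trans hxy; rewrite ler_pM2l// exprn_gt0.
    have := ler_wpM2l K0 hxy; rewrite /delta; lra.
Qed.

End consistency.

Theorem lemma4p1 (R : realType) (d : nat) (d_ge2 : (2 <= d)%N)
    (mu : 'rV[R]_d) (mu_unit : usphere d mu) (kappa : R) (kappa_gt0 : 0 < kappa)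
    (disp : measure_display) (Omega : measurableType disp)
    (P : probability Omega R) (z : nat -> {RV P >-> 'rV[R]_d})
    (z_iid : iid z (vMF mu kappa)) :
  let sample (n : nat) (w : Omega) := [seq z i w | i <- iota 0 n] in
  let rbar (n : nat) (w : Omega) := smean (sample n w) in
  let muhat (n : nat) (w : Omega) := unitize (rbar n w) in
  (forall n, (1 <= n)%N -> P [set w | rbar n w != 0] = 1%E) /\
  (forall n w, (1 <= n)%N -> rbar n w != 0 ->
     is_MLE kappa (sample n w) (muhat n w)) /\
  cvg_in_probability P muhat mu.
Proof.
move=> sample rbar muhat; split; [|split].
- move=> [//|n] _.
  have mS0 : measurable [set w | partial_sum z n.+1 w = 0].
    have := measurable_partial_sum z n.+1 measurableT (measurable_rV_set1 0).
    by rewrite setTI.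
  have -> : [set w | rbar n.+1 w != 0] = ~` [set w | partial_sum z n.+1 w = 0].
    apply/seteqP; split => w; rewrite /mkset /rbar smean_sample;
      by rewrite scaler_eq0 invr_eq0 pnatr_eq0 => /eqP.
  rewrite probability_setC// [X in (_ - X)%E](_ : _ = 0%E) ?sube0//.
  exact: (partial_sum_neq0 d_ge2 z_iid).
- move=> n w _; apply: (is_MLE_unitize_smean mu_unit) => //.
  (* That some observation has this law already makes the normalizing constant positive. *)
  apply: (vMF_const_gt0 (Q := distribution P (z 0))) => A mA.
  exact: (proj2 z_iid).
- exact: (muhat_cvg mu_unit kappa_gt0 z_iid).
Qed.
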